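(* Let $n\ge 1$ be an integer. The maximum density $\delta_{\Delta}=\pi/\sqrt{12}$ is achieved by a packing of $n$ equal disks in a triangular torus if and only if $n = n_1^2 + n_1n_2 + n_2^2$ for some integers $n_1, n_2$.
   Context: Identify the Euclidean plane with $\mathbb{C}$. For $g_1,g_2\in\mathbb{C}$ linearly independent over $\mathbb{R}$, let $\Lambda(g_1,g_2)=\{m_1g_1+m_2g_2 : m_1,m_2\in\mathbb{Z}\}$ and let $\mathbb{T}^2(\Lambda)=\mathbb{C}/\Lambda$ be the corresponding flat torus. Put $g_{\Delta}=e^{2\pi i/6}=\frac12+\frac{\sqrt3}{2}i$. A triangular torus is a torus $\mathbb{T}^2(\Lambda(z,g_{\Delta}z))$ with $z\in\mathbb{C}$, $z\neq 0$. A packing of $n$ equal disks in $\mathbb{T}^2(\Lambda)$ is a collection of $n$ disks of equal radius $r>0$ in $\mathbb{T}^2(\Lambda)$ with disjoint interiors; equivalently, the lifts to the plane of all the disks (all $\Lambda$-translates) have pairwise disjoint interiors. Its density is $n\pi r^2$ divided by the area of the torus. The number $\delta_{\Delta}=\pi/\sqrt{12}$ is the maximum density of any packing of equal disks in the plane. *)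

(* Defs.v *)
From HB Require Import structures.
From mathcomp Require Import all_boot all_order all_algebra.
From mathcomp Require Import complex.
From mathcomp Require Import all_classical all_reals all_analysis.

Set Implicit Arguments.
Unset Strict Implicit.
Unset Printing Implicit Defensive.

Import Order.TTheory GRing.Theory Num.Theory.
Import numFieldNormedType.Exports.

Local Open Scope classical_set_scope.
Local Open Scope ring_scope.
Local Open Scope complex_scope.

Definition lattice_pt (R : realType) (g1 g2 : R[i]) (m : int * int) : R[i] :=
  m.1%:~R * g1 + m.2%:~R * g2.

Definition lattice (R : realType) (g1 g2 : R[i]) : set R[i] :=
  range (lattice_pt g1 g2).

(* R[i]^o is R[i] with the topology of its norm. The norm of R[i] takes values
   in R[i] itself, whose order restricts to the one of R on reals, hence the
   embedding r%:C of the radius. *)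
Definition disk (R : realType) (c : R[i]) (r : R) : set R[i]^o :=
  [set w : R[i] | `|w - c| <= r%:C].

(* The n disks of the torus R[i]/L have centers the classes of the c i; the lifts
   of the i-th one are the disks centered at c i + l, l in L. They are indexed by
   the pairs (i, l), so distinct lifts of one and the same disk must also have
   disjoint interiors. *)
Definition is_torus_packing (R : realType) (L : set R[i]) (n : nat)
    (c : 'I_n -> R[i]) (r : R) : Prop :=
  0 < r /\
  forall (i j : 'I_n) (l m : R[i]), L l -> L m -> (i, l) <> (j, m) ->
    interior (disk (c i + l) r) `&` interior (disk (c j + m) r) = set0.

(* |Im (conj g1 * g2)| is the absolute value of the determinant of (g1, g2),
   i.e. the area of the fundamental parallelogram that they span. *)
Definition torus_area (R : realType) (g1 g2 : R[i]) : R :=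
  `|complex.Im (g1^* * g2)|.

Definition torus_density (R : realType) (g1 g2 : R[i]) (n : nat) (r : R) : R :=
  n%:R * pi * r ^+ 2 / torus_area g1 g2.

(* g_triangle = e^(2 i pi / 6) *)
Definition g_triangle (R : realType) : R[i] :=
  (1 / 2) +i* (Num.sqrt 3 / 2).

Definition delta_triangle (R : realType) : R := pi / Num.sqrt 12.

(* Main.v *)
(* Voronoi cells of the packing, truncated to the disc circumscribed about the
   regular hexagon, have disjoint translates under the lattice, so their areas
   add up to at most the area of the torus. Normalise so that this disc is the
   unit disc; distinct centres are then at distance at least sqrt 3. The cell is
   the disc minus the caps cut off by the neighbours at distance less than 2, and
   the circular sectors spanned by these caps are disjoint. A cap of half-angle
   a <= pi/6 is a sector of area a minus a triangle of area sin(2a)/2, which is at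
   least 3 sqrt 3/(2 pi) a by concavity of sin; since the half-angles add up to at
   most pi, the cell has area at least 3 sqrt 3/2, with equality only if there are
   six neighbours, all at distance sqrt 3. At the density pi/sqrt 12 all cells are
   tight, so with a centre x and a neighbour x + v all points of x + v Z[w], where
   w = e^(i pi/3), are centres, and there are no others. Hence a lattice vector of
   length sqrt(3n) lies in v Z[w], and n is the norm of an element of Z[w].
   Conversely Z[w] itself is an optimal packing, invariant under the ideal
   generated by n1 + n2 w, which has index n. *)
From HB Require Import structures.
Require Import Defs.
From mathcomp Require Import all_boot all_order all_algebra.
From mathcomp Require Import complex.
From mathcomp Require Import all_classical all_reals all_analysis.
From mathcomp Require Import measurable_realfun.
From mathcomp Require Import ring lra zify.

Set Implicit Arguments.
Unset Strict Implicit.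
Unset Printing Implicit Defensive.

Import Order.TTheory GRing.Theory Num.Theory.
Import numFieldNormedType.Exports.

Local Open Scope classical_set_scope.
Local Open Scope ring_scope.

(** * Area in the plane *)

Section PlanarArea.
Context {R : realType}.
Local Notation leb := (@lebesgue_measure R).
Local Notation plane := (measurableTypeR R * measurableTypeR R)%type.

Definition area : set plane -> \bar R := (leb \x leb)%E.
HB.instance Definition _ := Measure.on area.

(** The product measure integrates x-sections by definition; uniqueness of product measures
    identifies it with the one that integrates y-sections. *)
Lemma area_ysection (S : set plane) : measurable S ->
  area S = (\int[leb]_y leb (ysection S y))%E.
Proof.
move=> mS; rewrite /area (product_measure_unique (m' := (leb \x^ leb)%E))//.
by move=> A B mA mB; exact: product_measure2E.
Qed.

Lemma area_xsection (S : set plane) :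
  area S = (\int[leb]_x leb (xsection S x))%E.
Proof. by []. Qed.

(** The push-forward under a translation agrees with Lebesgue measure on half-open intervals, which
    determine the measure. *)
Lemma lebesgue_measure_translate (a : R) (S : set R) : measurable S ->
  leb ((fun x => x + a) @^-1` S) = leb S.
Proof.
move=> mS; have ma : measurable_fun setT ((fun x => x + a) : R -> measurableTypeR R).
  exact: measurable_funD.
apply/esym/(lebesgue_measure_unique (mu := pushforward leb _)) => //.
move=> _ [[b c]] _ <-; rewrite /pushforward/=.
rewrite [X in _ = leb X](_ : _ = [set` `]b - a, c - a]]); last first.
  by apply/seteqP; split => x /=; rewrite !in_itv/= ltrBlDr lerBrDr.
rewrite !lebesgue_measure_itv/= !lte_fin ltrD2r.
by case: ifP => // _; rewrite -!EFinB; congr (_%:E); lra.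
Qed.

(** Cavalieri's principle: a horizontal shear only translates each horizontal section. *)
Lemma area_shear_fst (f : R -> R) (S : set plane) : measurable_fun setT f ->
  measurable S -> area ((fun p : plane => (p.1 + f p.2, p.2)) @^-1` S) = area S.
Proof.
move=> mf mS.
have mT : measurable_fun setT (fun p : plane => (p.1 + f p.2, p.2) : plane).
  apply/measurable_fun_pair => //.
  by apply: measurable_funD => //; exact: measurableT_comp.
have mTS := mT measurableT _ mS; rewrite setTI in mTS.
rewrite !area_ysection//.
apply: eq_integral => y _.
rewrite -[in RHS](lebesgue_measure_translate (f y)); last exact: measurable_ysection.
by [].
Qed.

Lemma area_shear_snd (f : R -> R) (S : set plane) : measurable_fun setT f ->
  measurable S -> area ((fun p : plane => (p.1, p.2 + f p.1)) @^-1` S) = area S.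
Proof.
move=> mf mS.
have mT : measurable_fun setT (fun p : plane => (p.1, p.2 + f p.1) : plane).
  apply/measurable_fun_pair => //.
  by apply: measurable_funD => //; exact: measurableT_comp.
rewrite !area_xsection; apply: eq_integral => x _.
rewrite -[in RHS](lebesgue_measure_translate (f x)); last exact: measurable_xsection.
by [].
Qed.

Lemma measurable_preimage_translate (a b : R) (S : set plane) : measurable S ->
  measurable ((fun p : plane => (p.1 + a, p.2 + b)) @^-1` S).
Proof.
move=> mS; rewrite -[X in measurable X]setTI; apply: measurable_fun_pair => //.
  by apply: measurable_funD.
by apply: measurable_funD.
Qed.

Lemma area_translate (a b : R) (S : set plane) : measurable S ->
  area ((fun p : plane => (p.1 + a, p.2 + b)) @^-1` S) = area S.
Proof.
move=> mS; rewrite -[RHS](@area_shear_snd (cst b))//.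
rewrite -[RHS](@area_shear_fst (cst a))//.
rewrite -[X in measurable X]setTI; apply: measurable_fun_pair => //.
exact: measurable_funD.
Qed.

Lemma measurable_preimage_rotate (c s : R) (S : set plane) : measurable S ->
  measurable ((fun p : plane => (c * p.1 + s * p.2, c * p.2 - s * p.1)) @^-1` S).
Proof.
move=> mS; rewrite -[X in measurable X]setTI; apply: measurable_fun_pair => //.
  by apply: measurable_funD; apply: measurable_funM.
by apply: measurable_funB; apply: measurable_funM.
Qed.

(* A rotation is a product of three shears, except the half-turn, which is the
   square of a quarter-turn. *)
Lemma area_rotate (c s : R) (S : set plane) : c ^+ 2 + s ^+ 2 = 1 -> measurable S ->
  area ((fun p : plane => (c * p.1 + s * p.2, c * p.2 - s * p.1)) @^-1` S) = area S.
Proof.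
move=> cs1 mS.
wlog cN1 : c s cs1 S mS / c != -1 => [wl|].
  have [c_N1|/wl] := eqVneq c (-1); last exact.
  have c1' : 0 != -1 :> R by rewrite eq_sym oppr_eq0 oner_eq0.
  have s0 : s = 0.
    by apply/eqP; rewrite -sqrf_eq0; apply/eqP; rewrite c_N1 in cs1; lra.
  have q1 : (0 : R) ^+ 2 + 1 ^+ 2 = 1 by ring.
  rewrite -[RHS](wl 0 1)// -[RHS](wl 0 1)//; last exact: measurable_preimage_rotate.
  congr (area _); apply/funext => -[x y]; rewrite /preimage/mkset/= c_N1 s0.
  by congr (S _); congr (_, _); ring.
have c1 : 1 + c != 0 by rewrite addrC -[1]opprK subr_eq0.
(* For c = cos t and s = sin t this is tan (t / 2). *)
pose a := s / (1 + c).
have mlin k : measurable_fun setT (fun x : R => k * x : R) by exact: measurable_funM.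
pose A (p : plane) : plane := (p.1 + a * p.2, p.2).
pose B (p : plane) : plane := (p.1, p.2 + - s * p.1).
have mA : measurable_fun setT A.
  apply: measurable_fun_pair => //.
  by apply: measurable_funD => //; exact: measurable_funM.
have mB : measurable_fun setT B.
  apply: measurable_fun_pair => //.
  by apply: measurable_funD => //; exact: measurable_funM.
have mAS : measurable (A @^-1` S).
  by rewrite -[X in measurable X]setTI; exact: mA.
have mBAS : measurable (B @^-1` (A @^-1` S)).
  by rewrite -[X in measurable X]setTI; exact: mB.
rewrite -[RHS](area_shear_fst (mlin a))// -/A.
rewrite -[RHS](area_shear_snd (mlin (- s)))// -/B.
rewrite -[RHS](area_shear_fst (mlin a))// -/A.
have sa : s * a = 1 - c.
  by rewrite /a mulrA -expr2 (_ : s ^+ 2 = (1 - c) * (1 + c)) ?mulfK//; lra.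
have ac : a * c = s - a by rewrite -[s in RHS](divfK c1) -/a; ring.
congr (area _); apply/funext => -[x y]; rewrite /preimage/mkset/A/B/=.
by congr (S _); congr (_, _); ring: sa ac.
Qed.
Lemma measurable_ltr_set d (T : measurableType d) (f g : T -> R) :
  measurable_fun setT f -> measurable_fun setT g ->
  measurable [set p | f p < g p].
Proof.
move=> mf mg; rewrite -[X in measurable X]setTI.
rewrite (_ : [set p | _] = (fun p => f p < g p) @^-1` [set true])//.
by apply: (measurable_fun_ltr mf mg).
Qed.

Lemma measurable_ler_set d (T : measurableType d) (f g : T -> R) :
  measurable_fun setT f -> measurable_fun setT g ->
  measurable [set p | f p <= g p].
Proof.
move=> mf mg; rewrite -[X in measurable X]setTI.
rewrite (_ : [set p | _] = (fun p => f p <= g p) @^-1` [set true])//.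
by apply: (measurable_fun_ler mf mg).
Qed.

(** * Caps, triangles and sectors of the unit disc *)

Definition normSq (p : plane) : R := p.1 ^+ 2 + p.2 ^+ 2.
Definition dotp (p q : plane) : R := p.1 * q.1 + p.2 * q.2.

Lemma measurable_normSq : measurable_fun setT normSq.
Proof. by apply: measurable_funD; exact: measurable_funX. Qed.

Lemma measurable_dotp v : measurable_fun setT (dotp^~ v).
Proof. by apply: measurable_funD; exact: measurable_funM. Qed.

Definition udisk : set plane := [set p | normSq p < 1].

Lemma measurable_udisk : measurable udisk.
Proof. by apply: measurable_ltr_set => //; exact: measurable_normSq. Qed.

(** [Num.sqrt] vanishes on nonpositive reals, so the formula also covers the empty set. *)
Lemma lebesgue_measure_sqr_lt (a : R) :
  leb [set y | y ^+ 2 < a] = (2 * Num.sqrt a)%:E.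
Proof.
have [a0|a0] := leP a 0.
  rewrite ler0_sqrtr// mulr0 (_ : [set _ | _] = set0) ?measure0//.
  by apply/seteqP; split=> y //=; have := sqr_ge0 y; lra.
rewrite (_ : [set y | _] = `](- Num.sqrt a), (Num.sqrt a)[%classic).
  rewrite lebesgue_measure_itv/= lte_fin gtrN ?sqrtr_gt0//.
  by rewrite -EFinB; congr (_%:E); ring.
apply/seteqP; split=> y /=; rewrite in_itv/= -ltr_norml -sqrtr_sqr.
  by rewrite ltr_sqrt.
by rewrite ltr_sqrt.
Qed.

Lemma derivable_oo_LRcontinuousT (f : R -> R) (a b : R) :
  (forall x, derivable f x 1) -> derivable_oo_LRcontinuous f a b.
Proof.
move=> df; have cf x : {for x, continuous f}.
  exact/differentiable_continuous/derivable1_diffP.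
by split=> //; [exact/cvg_at_right_filter/cf|exact/cvg_at_left_filter/cf].
Qed.

Lemma derive1_cos : derive1 (@cos R) = (fun x => - sin x).
Proof. by apply/funext => x; rewrite derive1E derive_val. Qed.

(** The substitution x = cos t turns the integrand into 2 sin^2 t, with antiderivative t - sin t cos
    t. *)
Lemma integral_half_circle (h : R) : -1 <= h <= 1 ->
  (\int[leb]_(x in `[h, 1%R]) (2 * Num.sqrt (1 - x ^+ 2))%:E)%E =
  (acos h - h * Num.sqrt (1 - h ^+ 2))%:E.
Proof.
move=> h1; pose a := acos h.
have a0 : 0 <= a by exact: acos_ge0.
have api : a <= pi by exact: acos_lepi.
have ca : cos a = h by rewrite acosK// in_itv.
have sa : sin a = Num.sqrt (1 - h ^+ 2) by exact: sin_acos.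
rewrite -sa -/a -{1}ca -{1}(cos0 R).
have csin : continuous (fun x : R => - sin x).
  by move=> x; apply: continuousN; exact: continuous_sin.
rewrite (@integration_by_substitution_decreasing R cos
  (fun x => 2 * Num.sqrt (1 - x ^+ 2)) 0 a)//.
- rewrite derive1_cos.
  transitivity (\int[leb]_(t in `[0%R, a]) (2 * sin t ^+ 2)%:E)%E.
    apply: eq_integral => t; rewrite inE/= in_itv/= => /andP[t0 ta]; rewrite /=.
    congr (_%:E); rewrite !fctE/= -sin2cos2 sqrtr_sqr ger0_norm; last first.
      by rewrite sin_ge0_pi// t0 (le_trans ta).
    by rewrite opprK; ring.
  (* For h = 1 the interval is a point, while the fundamental theorem asks for distinct
     endpoints. *)
  have [<-|a_neq0] := eqVneq 0 a.
    by rewrite set_itv1 integral_set1 sin0 mulr0 subr0.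
  rewrite (@continuous_FTC2 R (fun t => 2 * sin t ^+ 2) (fun t => t - sin t * cos t) 0 a).
  + by rewrite sin0 mul0r subr0 -EFinB subr0 ca; congr (_%:E); ring.
  + by rewrite lt_neqAle a_neq0.
  + apply: continuous_subspaceT => x; apply: cvgM; first exact: cvg_cst.
    apply: (@continuous_comp _ _ _ sin (fun y : R => y ^+ 2)).
      exact: continuous_sin.
    exact: exprn_continuous.
  + by apply: derivable_oo_LRcontinuousT => x; exact: ex_derive.
  + move=> t _; rewrite derive1E derive_val /GRing.scale/=.
    by have := cos2Dsin2 t; lra.
- move=> x y xa ya yx; rewrite ltr_cos//.
  + by move: ya; rewrite !in_itv/= => /andP[-> /le_trans]; apply.
  + by move: xa; rewrite !in_itv/= => /andP[-> /le_trans]; apply.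
- by rewrite derive1_cos.
- by apply/cvg_ex; exists (- sin 0); rewrite derive1_cos; exact/cvg_at_right_filter/csin.
- by apply/cvg_ex; exists (- sin a); rewrite derive1_cos; exact/cvg_at_left_filter/csin.
- by apply: derivable_oo_LRcontinuousT => x; exact: derivable_cos.
- apply: continuous_subspaceT => x; apply: cvgM; first exact: cvg_cst.
  apply: continuous_comp; last exact: sqrt_continuous.
  apply: continuousB; first exact: cst_continuous.
  exact: exprn_continuous.
Qed.

Lemma area_vertical_cap (h : R) : -1 <= h <= 1 ->
  area [set p : plane | h <= p.1 /\ normSq p < 1] =
  (acos h - h * Num.sqrt (1 - h ^+ 2))%:E.
Proof.
move=> h1; rewrite -integral_half_circle// area_xsection.
rewrite [RHS]integral_mkcond; apply: eq_integral => x _.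
rewrite patchE; case: ifPn => [|].
  rewrite inE/= in_itv/= => /andP[hx x1].
  rewrite -lebesgue_measure_sqr_lt; congr (leb _).
  apply/seteqP; split=> y; rewrite /xsection/= inE/= /normSq/=; first by lra.
  by split=> //; lra.
move=> xh; rewrite (_ : xsection _ _ = set0) ?measure0//.
apply/seteqP; split=> y //; rewrite /xsection/= inE/= /normSq/= => -[hx xy1].
move: xh; rewrite notin_setE/= in_itv/= hx/=.
by have := sqr_ge0 y; nra.
Qed.

Lemma area_udisk : area udisk = (pi : R)%:E.
Proof.
(* At h = -1 the cap is the whole disc. *)
have := @area_vertical_cap (-1).
rewrite acosN1 sqrrN expr1n subrr sqrtr0 mulr0 subr0 => <-; last lra.
congr (area _); apply/seteqP; split=> -[x y]; rewrite /udisk /normSq/=; last by case.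
by move=> xy1; split=> //; have := sqr_ge0 y; nra.
Qed.

(** The triangle with apex 0 whose base is the chord at abscissa h. Its sides have slopes sqrt (1 -
    h^2) / h up to sign; squaring avoids the division and the absolute value. *)
Lemma area_vertical_triangle (h : R) : 0 < h < 1 ->
  area [set p : plane | 0 < p.1 < h /\ h ^+ 2 * p.2 ^+ 2 < (1 - h ^+ 2) * p.1 ^+ 2]
  = (h * Num.sqrt (1 - h ^+ 2))%:E.
Proof.
move=> /andP[h0 h1]; set k := Num.sqrt (1 - h ^+ 2).
have k2 : 1 - h ^+ 2 = k ^+ 2 by rewrite sqr_sqrtr//; nra.
have k0 : 0 <= k by exact: sqrtr_ge0.
transitivity (\int[leb]_(x in `[0%R, h]) (2 * (k / h) * x)%:E)%E; last first.
  rewrite (@continuous_FTC2 R (fun t => 2 * (k / h) * t)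
    (fun t => (k / h) * t ^+ 2) 0 h)//.
  + by rewrite -EFinB; congr (_%:E); field; lra.
  + by apply: continuous_subspaceT => x; exact: mulrl_continuous.
  + by apply: derivable_oo_LRcontinuousT => x; exact: ex_derive.
  + by move=> t _; rewrite derive1E derive_val /GRing.scale/=; ring.
rewrite area_xsection -integral_itv_bndo_bndc; last first.
  by apply/measurable_EFinP; exact: measurable_funM.
rewrite [RHS]integral_mkcond; apply: eq_integral => x _.
rewrite patchE; case: ifPn => [|].
  rewrite inE/= in_itv/= => /andP[x0 xh].
  rewrite -mulrA (_ : k / h * x = Num.sqrt ((k / h * x) ^+ 2)); last first.
    by rewrite sqrtr_sqr ger0_norm// mulr_ge0// divr_ge0// ltW.
  rewrite -lebesgue_measure_sqr_lt; congr (leb _).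
  have e : (k / h * x) ^+ 2 = (k * x) ^+ 2 / h ^+ 2 by field; lra.
  apply/seteqP; split=> y;
    rewrite /xsection/= inE/= e k2 ltr_pdivlMr ?exprn_gt0// exprMn.
    by rewrite mulrC => -[].
  move=> yk; split; last by rewrite mulrC.
  rewrite xh andbT lt_neqAle x0 andbT; apply/eqP => x_0.
  by have := sqr_ge0 (y * h); nra.
move=> xh; rewrite (_ : xsection _ _ = set0) ?measure0//.
apply/seteqP; split=> y //; rewrite /xsection/= inE/= => -[/andP[x0 xlh] _].
by move: xh; rewrite notin_setE/= in_itv/= (ltW x0) xlh.
Qed.

(** The polar angle has cosine above h, so this is the open sector of half-angle [acos h]. The chord
    at abscissa h cuts it into a cap and a triangle, and the terms h sqrt (1 - h^2) of their areas
    cancel. *)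
Lemma area_vertical_sector (h : R) : 0 < h < 1 ->
  area [set p : plane | [/\ normSq p < 1, 0 < p.1 & h ^+ 2 * normSq p < p.1 ^+ 2]]
  = (acos h)%:E.
Proof.
move=> h01; have /andP[h0 h1] := h01.
pose C := [set p : plane | h <= p.1 /\ normSq p < 1].
pose T := [set p : plane |
  0 < p.1 < h /\ h ^+ 2 * p.2 ^+ 2 < (1 - h ^+ 2) * p.1 ^+ 2].
have mC : measurable C.
  apply: measurableI; last exact: measurable_udisk.
  exact: measurable_ler_set.
have mT : measurable T.
  apply: measurableI; last first.
    by apply: measurable_ltr_set; apply: measurable_funM => //; exact: measurable_funX.
  rewrite [X in measurable X](_ : _ =
    [set p : plane | 0 < p.1] `&` [set p : plane | p.1 < h]).
    by apply: measurableI; exact: measurable_ltr_set.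
  by apply/seteqP; split=> p /= => [/andP|[-> ->]].
transitivity (area (C `|` T)).
  congr (area _); apply/seteqP; split=> -[x y]; rewrite /C/T/normSq/=.
    move=> [xy1 x0 hxy]; have [hx|xh] := leP h x; first by left.
    by right; rewrite x0; split=> //; lra.
  move=> [[hx xy1]|[/andP[x0 xh] hxy]].
    split=> //; first lra.
    have hh : h ^+ 2 <= x ^+ 2 by nra.
    have : h ^+ 2 * (x ^+ 2 + y ^+ 2) < h ^+ 2 * 1 by rewrite ltr_pM2l// exprn_gt0.
    by lra.
  have hh : x ^+ 2 < h ^+ 2 by nra.
  split=> //; last lra.
  by rewrite -(ltr_pM2l (exprn_gt0 2 h0)); lra.
rewrite measureU//; last first.
  by apply/seteqP; split=> -[x y]//; rewrite /C/T/= => -[[]]; lra.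
rewrite [X in (X + _)%E]area_vertical_cap; last lra.
rewrite [X in (_ + X)%E]area_vertical_triangle//.
by rewrite -EFinD; congr (_%:E); ring.
Qed.

End PlanarArea.

(** * A lower bound for the sine *)

Section Trigo.
Context {R : realType}.

(** The triple-angle formula gives 3 s - 4 s^3 = 1 for s = sin (pi / 6), that is, (s + 1)(2 s - 1)^2
    = 0. *)
Lemma sin_pi6 : sin (pi / 6) = 1 / 2 :> R.
Proof.
have p0 := @pi_gt0 R; set x := pi / 6.
have s0 : 0 < sin x by apply: sin_gt0_pi; rewrite /x; lra.
have e : sin (x + (x + x)) = 1 by rewrite -(sin_pihalf R); congr sin; rewrite /x; lra.
have c2 := cos2Dsin2 x; move: e; rewrite !sinD cosD => e.
have cc : cos x ^+ 2 = 1 - sin x ^+ 2 by lra.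
have e3 : 3 * sin x - 4 * sin x ^+ 3 = 1 by rewrite -[RHS]e; ring: cc.
have : (sin x + 1) * (2 * sin x - 1) ^+ 2 = 0 by lra.
move/eqP; rewrite mulf_eq0 sqrf_eq0 => /orP[/eqP|/eqP]; lra.
Qed.

Lemma cos_pi6 : cos (pi / 6) = Num.sqrt 3 / 2 :> R.
Proof.
have p0 := @pi_gt0 R.
have c0 : 0 < cos (pi / 6 : R) by apply: cos_gt0_pihalf; apply/andP; split; lra.
have c2 := cos2Dsin2 (pi / 6 : R); rewrite sin_pi6 in c2.
have s0 : 0 <= Num.sqrt 3 :> R by exact: sqrtr_ge0.
have s2 : Num.sqrt 3 ^+ 2 = 3 :> R by rewrite sqr_sqrtr.
by nra.
Qed.

Lemma sin_pi3 : sin (pi / 3) = Num.sqrt 3 / 2 :> R.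
Proof.
rewrite (_ : pi / 3 = pi / 6 + pi / 6); last by field.
by rewrite sinD sin_pi6 cos_pi6; field.
Qed.

(* By concavity the graph of sin lies above its chord over [0, pi/3]. *)
Lemma sin_gt_chord (a : R) : 0 < a < pi / 3 -> 3 * Num.sqrt 3 / (2 * pi) * a < sin a.
Proof.
move=> /andP[a0 api]; set k := 3 * _ / _.
have p0 := @pi_gt0 R.
have kpi : k * (pi / 3) = sin (pi / 3) by rewrite sin_pi3 /k; field; lra.
have cs (x y : R) : {within `[x, y], continuous sin}.
  by apply: continuous_subspaceT => z; exact: continuous_sin.
have [x1] := @MVT _ sin cos 0 a a0 (fun x _ => is_derive_sin x) (cs _ _).
have [x2] := @MVT _ sin cos a (pi / 3) api (fun x _ => is_derive_sin x) (cs _ _).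
rewrite !in_itv/= sin0 => /andP[ax2 x2pi] e2 /andP[x10 x1a] e1.
have : cos x2 < cos x1 by rewrite ltr_cos ?in_itv/=; [lra|apply/andP; split; lra..].
rewrite !subr0 in e1 *; rewrite e1 in e2 * => c21.
rewrite ltr_pM2r// -(ltr_pM2r (_ : 0 < pi / 3)) ?kpi; last lra.
suff : 0 < (cos x1 - cos x2) * (pi / 3 - a) by lra.
by rewrite mulr_gt0 ?subr_gt0.
Qed.

End Trigo.

(** * Truncated Voronoi cells *)

Section Cell.
Context {R : realType}.
Local Notation plane := (measurableTypeR R * measurableTypeR R)%type.
Implicit Types (p q v w : plane) (V : seq plane).

(** The distance from 0 to the perpendicular bisector of 0 and [v]. *)
Definition half_norm v : R := Num.sqrt (normSq v) / 2.
Definition half_angle v : R := acos (half_norm v).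

(** The first condition says that [p] is at least as close to [v] as to 0. *)
Definition cap v : set plane :=
  [set p | normSq v <= 2 * dotp p v /\ normSq p < 1].

(** The last inequality is cos (angle of [p] and [v]) > |v| / 2, squared and cleared of
    denominators: this is the open sector spanned by the cap of [v]. *)
Definition sector v : set plane :=
  [set p | [/\ normSq p < 1, 0 < dotp p v &
              normSq p * normSq v ^+ 2 < 4 * dotp p v ^+ 2]].

Definition cell V : set plane :=
  [set p | normSq p < 1 /\ forall v, v \in V -> 2 * dotp p v < normSq v].

Lemma measurable_cap v : measurable (cap v).
Proof.
apply: measurableI; last exact: measurable_udisk.
by apply: measurable_ler_set => //; apply: measurable_funM => //; exact: measurable_dotp.
Qed.

Lemma measurable_sector v : measurable (sector v).
Proof.
rewrite (_ : sector v = @udisk R `&` ([set p : plane | 0 < dotp p v] `&`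
   [set p : plane | normSq p * normSq v ^+ 2 < 4 * dotp p v ^+ 2])); last first.
  by apply/seteqP; split=> p; rewrite /sector /udisk/=; [case|case=> ? []].
apply: measurableI; first exact: measurable_udisk.
apply: measurableI; first by apply: measurable_ltr_set => //; exact: measurable_dotp.
apply: measurable_ltr_set => //; apply: measurable_funM => //.
  exact: measurable_normSq.
by apply: measurable_funX; exact: measurable_dotp.
Qed.

Lemma cell_nil : cell [::] = @udisk R.
Proof. by apply/seteqP; split=> p; rewrite /cell/udisk/=; [case|]. Qed.

Lemma cell_cons v V : cell (v :: V) = cell V `\` cap v.
Proof.
apply/seteqP; split=> p; rewrite /cell/cap/=.
  move=> [p1 pV]; split; first by split=> // w wV; apply: pV; rewrite inE wV orbT.
  by move=> [vp _]; have := pV v (mem_head _ _); lra.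
move=> [[p1 pV] ncap]; split=> // w; rewrite inE => /orP[/eqP ->|]; last exact: pV.
by rewrite ltNge; apply/negP => vp; apply: ncap.
Qed.

Lemma measurable_cell V : measurable (cell V).
Proof.
elim: V => [|v V IH]; first by rewrite cell_nil; exact: measurable_udisk.
by rewrite cell_cons; apply: measurableD => //; exact: measurable_cap.
Qed.

Lemma half_normE v : half_norm v ^+ 2 = normSq v / 4.
Proof.
rewrite /half_norm expr_div_n sqr_sqrtr; first by congr (_ / _); ring.
by rewrite /normSq addr_ge0// sqr_ge0.
Qed.

(** Coordinates in the orthonormal frame whose first vector is v / |v|, in which caps and sectors
    become vertical. *)
Definition to_frame v p : plane :=
  let t := Num.sqrt (normSq v) in
  (v.1 / t * p.1 + v.2 / t * p.2, v.1 / t * p.2 - v.2 / t * p.1).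

Lemma to_frame_unit v : 0 < normSq v ->
  (v.1 / Num.sqrt (normSq v)) ^+ 2 + (v.2 / Num.sqrt (normSq v)) ^+ 2 = 1.
Proof.
move=> v0; rewrite !expr_div_n -mulrDl sqr_sqrtr; last exact: ltW.
by rewrite divff// gt_eqF.
Qed.

Lemma area_to_frame v (S : set plane) : 0 < normSq v -> measurable S ->
  area (to_frame v @^-1` S) = area S.
Proof. by move=> v0 mS; apply: area_rotate => //; exact: to_frame_unit. Qed.

Lemma normSq_to_frame v p : 0 < normSq v -> normSq (to_frame v p) = normSq p.
Proof.
move=> /to_frame_unit; rewrite /normSq /to_frame/=.
set a := _ / _; set b := _ / _ => ab.
have aE : a ^+ 2 = 1 - b ^+ 2 by lra.
by ring: aE.
Qed.

Lemma dotp_to_frame v p : 0 < normSq v ->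
  dotp p v = Num.sqrt (normSq v) * (to_frame v p).1.
Proof.
move=> v0; rewrite /dotp /to_frame/=.
by field; rewrite gt_eqF// sqrtr_gt0.
Qed.

Lemma area_cap v : 0 < normSq v <= 4 ->
  area (cap v) = (half_angle v - half_norm v * Num.sqrt (1 - half_norm v ^+ 2))%:E.
Proof.
move=> /andP[v0 v4].
have t0 : 0 < half_norm v by rewrite divr_gt0// sqrtr_gt0.
have h2 := half_normE v.
have st : Num.sqrt (normSq v) = 2 * half_norm v by rewrite /half_norm; field.
have h1 : -1 <= half_norm v <= 1 by apply/andP; split; nra.
rewrite -area_vertical_cap// -[RHS](area_to_frame v0); last first.
  apply: measurableI; last exact: measurable_udisk.
  exact: measurable_ler_set.
congr (area _); apply/seteqP; split=> p; rewrite /cap/preimage/mkset.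
  move: (dotp_to_frame p v0) (normSq_to_frame p v0); rewrite st.
  case: (to_frame v p) => x y /= -> <- [vp p1]; split=> //.
  by rewrite -(ler_pM2l t0); lra.
move: (dotp_to_frame p v0) (normSq_to_frame p v0); rewrite st.
case: (to_frame v p) => x y /= -> <- [vp p1]; split=> //.
by rewrite -(ler_pM2l t0) in vp; lra.
Qed.

Lemma area_sector v : 0 < normSq v < 4 -> area (sector v) = (half_angle v)%:E.
Proof.
move=> /andP[v0 v4].
have t0 : 0 < half_norm v by rewrite divr_gt0// sqrtr_gt0.
have h2 := half_normE v.
have st : Num.sqrt (normSq v) = 2 * half_norm v by rewrite /half_norm; field.
have h1 : 0 < half_norm v < 1 by apply/andP; split; nra.
rewrite -area_vertical_sector// -[RHS](area_to_frame v0).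
  congr (area _); apply/seteqP; split=> p; rewrite /sector/preimage/mkset.
    move: (dotp_to_frame p v0) (normSq_to_frame p v0); rewrite st.
    case: (to_frame v p) => x y /= -> <-; rewrite pmulr_rgt0; last lra.
    move=> -[p1 x0 pv]; split=> //.
    by rewrite h2 -(ltr_pM2l v0); move: pv; rewrite exprMn exprMn h2; lra.
  move: (dotp_to_frame p v0) (normSq_to_frame p v0); rewrite st.
  case: (to_frame v p) => x y /= -> <-; rewrite pmulr_rgt0; last lra.
  move=> -[p1 x0 pv]; split=> //.
  by rewrite h2 -(ltr_pM2l v0) in pv; rewrite exprMn exprMn h2; lra.
rewrite (_ : [set p | _] = @udisk R `&` ([set p : plane | 0 < p.1] `&`
   [set p : plane | half_norm v ^+ 2 * normSq p < p.1 ^+ 2])); last first.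
  by apply/seteqP; split=> p; rewrite /udisk/=; [case|case=> ? []].
apply: measurableI; first exact: measurable_udisk.
apply: measurableI; first exact: measurable_ltr_set.
apply: measurable_ltr_set; last exact: measurable_funX.
by apply: measurable_funM => //; exact: measurable_normSq.
Qed.

(** * Disjointness of the sectors and the sum of the half-angles *)

Definition distSq v w : R := (v.1 - w.1) ^+ 2 + (v.2 - w.2) ^+ 2.

(** All distances between centres are at least sqrt 3. The bound 4 selects the centres whose
    bisector with 0 meets the open unit disc. *)
Definition neighbours V : bool :=
  all (fun v => 3 <= normSq v < 4) V && pairwise (fun v w => 3 <= distSq v w) V.

Lemma neighbours_cons v V : neighbours (v :: V) =
  [&& 3 <= normSq v < 4, all (fun w => 3 <= distSq v w) V & neighbours V].
Proof. by rewrite /neighbours/= -!andbA; do !bool_congr. Qed.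

(* If q is the direction of a common point p, then v, w and 0 all lie in the unit
   disc centred at q, and [|v + w - 3 q|^2 >= 0] contradicts their distances. *)
Lemma sector_disjoint v w p : 3 <= normSq v -> 3 <= normSq w -> 3 <= distSq v w ->
  sector v p -> sector w p -> False.
Proof.
move=> v3 w3 vw3 [p1 pv0 pv] [_ pw0 pw].
have p0 : 0 < normSq p.
  rewrite lt_neqAle eq_sym addr_ge0 ?sqr_ge0// andbT; apply: contraTneq pv => /eqP.
  rewrite /normSq paddr_eq0 ?sqr_ge0// !sqrf_eq0 => /andP[/eqP p10 /eqP p20].
  by move: pv0; rewrite /dotp p10 p20 !mul0r addr0 ltxx.
have r0 : 0 < Num.sqrt (normSq p) by rewrite sqrtr_gt0.
have rr : Num.sqrt (normSq p) ^+ 2 = normSq p by rewrite sqr_sqrtr// ltW.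
move: r0 rr; set r := Num.sqrt _ => r0 rr.
have key u : 3 <= normSq u -> 0 < dotp p u ->
    normSq p * normSq u ^+ 2 < 4 * dotp p u ^+ 2 -> r * normSq u < 2 * dotp p u.
  move=> u3 pu0; rewrite -rr ltNge => /negP pu; rewrite ltNge; apply/negP => ur.
  apply: pu; have : 2 * dotp p u * (2 * dotp p u) <= r * normSq u * (r * normSq u).
    by rewrite ler_pM//; lra.
  by lra.
have {pv}kv := key _ v3 pv0 pv.
have {pw}kw := key _ w3 pw0 pw.
(* With p = r q this is r^2 |v + w - 3 q|^2. By [kv] and [kw] it is less than r^2 (9 - |v|^2 - |w|^2
   - |v - w|^2), which is nonpositive. *)
have : 0 <= (r * (v.1 + w.1) - 3 * p.1) ^+ 2 + (r * (v.2 + w.2) - 3 * p.2) ^+ 2.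
  by rewrite addr_ge0 ?sqr_ge0.
rewrite (_ : _ + _ = r ^+ 2 * (2 * normSq v + 2 * normSq w - distSq v w)
   - 3 * r * (2 * dotp p v + 2 * dotp p w) + 9 * normSq p); last first.
  by rewrite /normSq /distSq /dotp; ring.
rewrite -rr.
have : r * (r * normSq v + r * normSq w) < r * (2 * dotp p v + 2 * dotp p w).
  by rewrite ltr_pM2l//; lra.
have : 0 <= r ^+ 2 * (normSq v + normSq w + distSq v w - 9).
  by rewrite mulr_ge0 ?sqr_ge0//; lra.
by lra.
Qed.

(** What the sectors leave of the disc. As they are disjoint, its area is pi minus the sum of the
    half-angles, which is therefore at most pi. *)
Definition core V : set plane :=
  [set p | normSq p < 1 /\ forall v, v \in V -> ~ sector v p].

Lemma core_nil : core [::] = @udisk R.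
Proof. by apply/seteqP; split=> p; rewrite /core/udisk/=; [case|]. Qed.

Lemma core_cons v V : core (v :: V) = core V `\` sector v.
Proof.
apply/seteqP; split=> p; rewrite /core/=.
  move=> [p1 pV]; split; last exact/pV/mem_head.
  by split=> // w wV; apply: pV; rewrite inE wV orbT.
by move=> [[p1 pV] npv]; split=> // w; rewrite inE => /orP[/eqP ->//|]; exact: pV.
Qed.

Lemma measurable_core V : measurable (core V).
Proof.
elim: V => [|v V IH]; first by rewrite core_nil; exact: measurable_udisk.
by rewrite core_cons; apply: measurableD => //; exact: measurable_sector.
Qed.

Lemma area_core V : neighbours V ->
  area (core V) = (pi - \sum_(v <- V) half_angle v)%:E.
Proof.
elim: V => [_|v V IH]; first by rewrite core_nil big_nil subr0 area_udisk.
rewrite neighbours_cons => /and3P[/andP[v3 v4] /allP vV nV].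
rewrite core_cons measureD//; last 3 first.
- exact: measurable_core.
- exact: measurable_sector.
- by have /= -> := IH nV; rewrite ltry.
rewrite setIidr => [|p vp]; last first.
  split; first by case: vp.
  move=> w wV; apply: (sector_disjoint v3 _ (vV _ wV) vp).
  by case/andP: nV => /allP/(_ _ wV)/andP[].
rewrite /= (IH nV) area_sector ?v4 ?andbT; last lra.
by rewrite -EFinB big_cons; congr _%:E; ring.
Qed.

Lemma sum_half_angle_le V : neighbours V -> \sum_(v <- V) half_angle v <= pi.
Proof.
move=> nV; have /= := measure_ge0 (@area R) (core V).
by rewrite area_core// lee_fin subr_ge0.
Qed.

(** By subadditivity, each cap that is removed costs at most its own area. *)
Lemma area_cell_ge V : all (fun v => 3 <= normSq v < 4) V ->
  (pi%:E <= area (cell V) + (\sum_(v <- V)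
    (half_angle v - half_norm v * Num.sqrt (1 - half_norm v ^+ 2)))%:E)%E.
Proof.
elim: V => [_|v V IH /= /andP[/andP[v3 v4] /IH{}IH]].
  by rewrite big_nil cell_nil adde0 area_udisk.
apply: (le_trans IH); rewrite big_cons EFinD -area_cap; last lra.
rewrite addeA leeD2r// cell_cons.
have mcap := measurable_cap v; have mcell := measurable_cell V.
have mD : measurable (cell V `\` cap v) by exact: measurableD.
apply: (le_trans _ (measureU2 _ _ _)) => //.
apply: le_measure; rewrite ?inE//; first exact: measurableU.
by move=> p cp; have [|] := pselect (cap v p); [right|left].
Qed.

(** The slope of the chord of sin over [0, pi/3]. Times pi, it is the area of the regular hexagon
    inscribed in the unit circle. *)
Definition chord_slope : R := 3 * Num.sqrt 3 / (2 * pi).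

(** By the mean value theorem the slope is cos x for some x strictly between 0 and pi/3. *)
Lemma chord_slope_lt1 : chord_slope < 1.
Proof.
have p0 := @pi_gt0 R.
have kpi : chord_slope * (pi / 3) = sin (pi / 3).
  by rewrite sin_pi3 /chord_slope; field; lra.
have p3 : 0 < pi / 3 :> R by lra.
have [] := @MVT _ sin cos 0 (pi / 3) p3 (fun x _ => is_derive_sin x).
  by apply: continuous_subspaceT => z; exact: continuous_sin.
move=> x; rewrite in_itv/= => /andP[x0 xpi].
rewrite sin0 !subr0 -kpi => /(mulIf (lt0r_neq0 p3)) ->.
by rewrite -[ltRHS]cos0 ltr_cos ?in_itv/=; [lra|apply/andP; split; lra..].
Qed.

Lemma half_angle_range v : 3 <= normSq v < 4 ->
  [/\ 0 < half_angle v <= pi / 6, cos (half_angle v) = half_norm v &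
      sin (half_angle v) = Num.sqrt (1 - half_norm v ^+ 2)].
Proof.
move=> /andP[v3 v4]; have p0 := @pi_gt0 R.
have t0 : 0 <= half_norm v by rewrite divr_ge0// sqrtr_ge0.
have h2 := half_normE v.
have h1 : -1 <= half_norm v < 1 by apply/andP; split; nra.
have h1' : -1 <= half_norm v <= 1 by lra.
have ca : cos (half_angle v) = half_norm v by rewrite acosK// in_itv.
have a0 : 0 < half_angle v by exact: acos_gt0.
split=> //; last exact: sin_acos.
rewrite a0/= leNgt -ltr_cos ?in_itv/=; last 2 first.
- by apply/andP; split; lra.
- by apply/andP; split; [lra|exact: acos_lepi].
rewrite cos_pi6 ca -leNgt.
have s3 : Num.sqrt 3 ^+ 2 = 3 :> R by rewrite sqr_sqrtr.
have := sqrtr_ge0 (3 : R).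
by nra.
Qed.

(** The triangle has area cos a sin a = sin (2 a) / 2, to which the chord bound applies at 2 a; it
    is strict unless a = pi/6. *)
Lemma half_angle_chord v : 3 <= normSq v < 4 ->
  chord_slope * half_angle v <= half_norm v * Num.sqrt (1 - half_norm v ^+ 2)
    ?= iff (normSq v == 3).
Proof.
move=> v34; have [/andP[a0 api] ca sa] := half_angle_range v34.
have p0 := @pi_gt0 R; have h2 := half_normE v.
rewrite -sa -ca; move: api; rewrite le_eqVlt => /predU1P[a6|a6].
  rewrite a6 cos_pi6 sin_pi6 (_ : normSq v = 3).
    rewrite (_ : _ * (pi / 6) = Num.sqrt 3 / 2 * (1 / 2)).
      by split; rewrite ?lexx ?eqxx.
    by rewrite /chord_slope; field; lra.
  move: h2; rewrite -ca a6 cos_pi6 expr_div_n sqr_sqrtr//; lra.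
have := @sin_gt_chord R (2 * half_angle v).
rewrite -/chord_slope mulr2n mulrDl mul1r sinD => chord.
have lt : chord_slope * half_angle v < cos (half_angle v) * sin (half_angle v).
  by suff : 0 < half_angle v + half_angle v < pi / 3; [move/chord; lra|lra].
split; first exact: ltW.
rewrite lt_eqF//; apply/esym/negbTE/eqP => v3; move: h2; rewrite -ca v3 => c2.
have s3 : Num.sqrt 3 ^+ 2 = 3 :> R by rewrite sqr_sqrtr.
have s30 := sqrtr_ge0 (3 : R).
have : cos (pi / 6) < cos (half_angle v).
  by rewrite ltr_cos ?in_itv/=; [lra|apply/andP; split; lra..].
by rewrite cos_pi6; nra.
Qed.

Lemma half_angle_min v : normSq v = 3 -> half_angle v = pi / 6.
Proof.
move=> v3; have p0 := @pi_gt0 R.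
by rewrite /half_angle /half_norm v3 -cos_pi6 cosK// in_itv/=; apply/andP; split; lra.
Qed.

(** Let S be the sum of the half-angles, G that of the triangle areas, k the chord slope. The cell
    has area at least pi - S + G, which exceeds k pi by (1 - k)(pi - S) + (G - k S), both terms
    being nonnegative. In case of equality both vanish: G = k S puts all neighbours at distance sqrt
    3, with half-angle pi/6, and S = pi makes them six. *)
Lemma area_cell V : neighbours V -> exists2 x : R, area (cell V) = x%:E &
  3 * Num.sqrt 3 / 2 <= x /\
  (x = 3 * Num.sqrt 3 / 2 -> size V = 6%N /\ all (fun v => normSq v == 3) V).
Proof.
move=> nV; have p0 := @pi_gt0 R.
have /andP[aV _] := nV.
have fV : area (cell V) \is a fin_num.
  rewrite ge0_fin_numE ?measure_ge0//.
  rewrite (@le_lt_trans _ _ (area (@udisk R)))//; last by rewrite area_udisk ltry.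
  apply: le_measure; rewrite ?inE; [exact: measurable_cell|exact: measurable_udisk|].
  by move=> p [].
exists (fine (area (cell V))); first by rewrite fineK.
have := area_cell_ge aV; rewrite -(fineK fV) -EFinD lee_fin /=.
set x := fine _; rewrite big_split/= sumrN.
have := sum_half_angle_le nV; set S := \sum_(v <- V) half_angle v => Spi.
set G := \sum_(v <- V) _ => xG.
have k1 := chord_slope_lt1.
have kpi : chord_slope * pi = 3 * Num.sqrt 3 / 2 :> R.
  by rewrite /chord_slope; field; lra.
rewrite -kpi.
have gap_ge0 v : v \in V -> 0 <=
    half_norm v * Num.sqrt (1 - half_norm v ^+ 2) - chord_slope * half_angle v.
  by move=> /(allP aV) /half_angle_chord[]; rewrite subr_ge0.
have gapE : \sum_(v <- V) (half_norm v * Num.sqrt (1 - half_norm v ^+ 2)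
   - chord_slope * half_angle v) = G - chord_slope * S.
  by rewrite sumrB -mulr_sumr.
have gap0 : 0 <= G - chord_slope * S.
  by rewrite -gapE big_seq sumr_ge0.
have Sk : 0 <= (1 - chord_slope) * (pi - S) by rewrite mulr_ge0; lra.
split; first lra.
move=> xE.
have GkS : G - chord_slope * S = 0 by lra.
have V3 : all (fun v => normSq v == 3) V.
  apply/allP => v vV; have [_ <-] := half_angle_chord (allP aV _ vV).
  move/eqP: GkS; rewrite -gapE big_seq psumr_eq0//.
  by move=> /allP/(_ _ vV); rewrite vV/= subr_eq0 eq_sym.
split=> //.
have : (1 - chord_slope) * (pi - S) = 0 by lra.
move/eqP; rewrite mulf_eq0 => /orP[|/eqP Spi0]; first by move/eqP=> k1E; exfalso; lra.
have : S = (size V)%:R * (pi / 6).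
  rewrite /S big_seq (eq_bigr (fun=> pi / 6)) -?big_seq.
    by rewrite big_const_seq count_predT iter_addr_0 mulr_natl.
  by move=> v /(allP V3)/eqP/half_angle_min.
rewrite (_ : S = pi) => [pi6|]; last lra.
apply/eqP; rewrite -(eqr_nat R); apply/eqP.
by apply: (mulIf (lt0r_neq0 p0)); lra.
Qed.

End Cell.

(** * Disjoint lattice translates *)

Section TilingBound.
Context {R : realType}.
Local Notation plane := (measurableTypeR R * measurableTypeR R)%type.

Lemma area_finite_union (T : finType) (F : T -> set plane) (S : set plane)
    (f : T -> R) (s : R) :
  (forall t, measurable (F t)) -> (forall t, area (F t) = (f t)%:E) ->
  measurable S -> area S = s%:E -> (forall t, F t `<=` S) -> trivIset setT F ->
  \sum_t f t <= s.
Proof.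
move=> mF aF mS aS FS tF; rewrite -lee_fin -sumEFin.
have := @measure_fin_bigcup _ _ _ (@area R) T setT F finite_finset tF (fun i _ => mF i).
rewrite (fsbigE (index_enum T)) ?index_enum_uniq//=; last first.
  by move=> i _; rewrite mem_index_enum.
rewrite (eq_bigl xpredT); last by move=> i; rewrite in_setT.
rewrite (eq_bigr (fun t => (f t)%:E)) => [<-|t _]; last exact: aF.
rewrite -aS; apply: le_measure; rewrite ?inE//.
  exact: fin_bigcup_measurable finite_finset (fun i _ => mF i).
by move=> p [t _]; exact: FS.
Qed.

Lemma boxE (a b c d : R) : [set p : plane | a <= p.1 <= b /\ c <= p.2 <= d] =
  ([set` `[a, b]] : set (measurableTypeR R)) `*`
  ([set` `[c, d]] : set (measurableTypeR R)).
Proof. by apply/seteqP; split=> -[x y]; rewrite /= !in_itv. Qed.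

Lemma area_box (a b c d : R) : a <= b -> c <= d ->
  area [set p : plane | a <= p.1 <= b /\ c <= p.2 <= d] =
  ((b - a) * (d - c))%:E.
Proof.
move=> ab cd; rewrite boxE /area product_measure1E//=.
rewrite !lebesgue_measure_itv/= !lte_fin.
move: ab cd; rewrite !le_eqVlt => /predU1P[->|ab] /predU1P[->|cd];
  by rewrite ?ltxx ?subrr ?mul0r ?mulr0 ?mule0 ?mul0e// ?ab ?cd// -?EFinB.
Qed.

(** Comparison of leading coefficients in K. For K >= 1 the lower-order terms are at most D K with D
    = C (u + v) + C^2, and any K > D / (s - u v) refutes s > u v. *)
Lemma le_of_quadratic_bound (s u v C : R) : 0 <= u -> 0 <= v -> 0 <= C ->
  (forall K : nat, K%:R ^+ 2 * s <= (u * K%:R + C) * (v * K%:R + C)) -> s <= u * v.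
Proof.
move=> u0 v0 C0 sK; rewrite leNgt; apply/negP => uvs.
pose e := s - u * v; have e0 : 0 < e by rewrite subr_gt0.
have D0 : 0 <= C * (u + v) + C ^+ 2 by rewrite addr_ge0 ?sqr_ge0// mulr_ge0// addr_ge0.
set D := C * (u + v) + C ^+ 2 in D0.
pose K := (Num.trunc (D / e)).+1.
have K1 : 1 <= K%:R :> R by rewrite ler1n.
have : D / e < K%:R by exact: truncnS_gt.
rewrite ltr_pdivrMr// => DK.
have /= := sK K.
have : C ^+ 2 <= C ^+ 2 * K%:R by rewrite ler_peMr// sqr_ge0.
have : D * K%:R < K%:R * e * K%:R by rewrite ltr_pM2r//; lra.
by rewrite /D /e; nra.
Qed.

Variables (L H : R) (n : nat).

Definition lat (m : int * int) : plane :=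
  (L * m.1%:~R + L / 2 * m.2%:~R, H * m.2%:~R).

(** For each K, the K^2 translates of every [B i] fit disjointly into a rectangle with sides L K + 2
    |M| and H K + 2 |M|; then K tends to infinity. *)
Lemma packing_area_le (B : 'I_n -> set plane) (b : 'I_n -> R) (M : R) :
  0 < L -> 0 < H ->
  (forall i, measurable (B i)) -> (forall i, area (B i) = (b i)%:E) ->
  (forall i p, B i p -> `|p.1| <= M /\ `|p.2| <= M) ->
  (forall i j l m p, B i (p.1 - (lat l).1, p.2 - (lat l).2) ->
     B j (p.1 - (lat m).1, p.2 - (lat m).2) -> (i, l) = (j, m)) ->
  \sum_i b i <= L * H.
Proof.
move=> L0 H0 mB aB BM disj.
have [n0|n0] := posnP n.
  by rewrite big1 ?mulr_ge0 ?ltW// => -[k kn]; exfalso; rewrite n0 in kn.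
apply: (@le_of_quadratic_bound _ _ _ (2 * `|M|));
  [exact: ltW|exact: ltW|by rewrite mulr_ge0|].
move=> K; pose T : finType := ('I_n * ('I_K * 'I_K))%type.
(* odd rows of the lattice are shifted by half a step only, so that the
   translates fill a rectangle rather than a parallelogram *)
pose idx (ab : 'I_K * 'I_K) : int * int :=
  ((ab.1 : nat)%:Z - ((ab.2 : nat)./2)%:Z, (ab.2 : nat)%:Z).
pose F (t : T) : set plane :=
  (fun p : plane => (p.1 + - (lat (idx t.2)).1, p.2 + - (lat (idx t.2)).2)) @^-1` B t.1.
have latE ab : lat (idx ab) = (L * ab.1%:R + L / 2 * (odd ab.2)%:R, H * ab.2%:R).
  rewrite /lat /idx /= rmorphB/= -!pmulrn; congr (_, _).
  have e : (ab.2 : nat)%:R = (odd ab.2)%:R + 2 * ((ab.2)./2)%:R :> R.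
    by rewrite -natrM -natrD mul2n odd_double_half.
  by rewrite e; field.
pose S := [set p : plane | - `|M| <= p.1 <= L * K%:R + `|M| /\
  - `|M| <= p.2 <= H * K%:R + `|M|].
have K0 : 0 <= K%:R :> R by [].
have LK0 : 0 <= L * K%:R by rewrite mulr_ge0// ltW.
have HK0 : 0 <= H * K%:R by rewrite mulr_ge0// ltW.
have M0 := normr_ge0 M.
rewrite (_ : _ * _ = \sum_(t : T) b t.1); last first.
  rewrite -(pair_bigA _ (fun i _ => b i))/= mulr_sumr; apply: eq_bigr => i _.
  by rewrite sumr_const card_prod card_ord -[RHS]mulr_natl natrM expr2.
apply: (@area_finite_union T F S) => //.
- by move=> t; exact: measurable_preimage_translate.
- by move=> t; rewrite area_translate.
- by rewrite /S boxE; exact: measurableX.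
- rewrite area_box; [congr (_%:E); ring|lra|lra].
- move=> [i [a c]] [x y]; rewrite /F /S /preimage/mkset latE/= => /BM[]/=.
  have MM := ler_norm M.
  move=> /le_trans/(_ MM); rewrite ler_norml => /andP[x1 x2].
  move=> /le_trans/(_ MM); rewrite ler_norml => /andP[y1 y2].
  have aK : a%:R + 1 <= K%:R :> R by rewrite natr1 ler_nat.
  have cK : c%:R + 1 <= K%:R :> R by rewrite natr1 ler_nat.
  have a0 : 0 <= a%:R :> R by [].
  have c0 : 0 <= c%:R :> R by [].
  have o0 : 0 <= (odd c)%:R :> R by rewrite ler0n.
  have o1 : (odd c)%:R <= 1 :> R by rewrite lern1 leq_b1.
  have La : 0 <= L * a%:R by rewrite mulr_ge0// ltW.
  have LaK : 0 <= L * (K%:R - 1 - a%:R) by rewrite mulr_ge0 ?(ltW L0)//; lra.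
  have Hc : 0 <= H * c%:R by rewrite mulr_ge0// ltW.
  have HcK : 0 <= H * (K%:R - 1 - c%:R) by rewrite mulr_ge0 ?(ltW H0)//; lra.
  have Lo : 0 <= L * (odd c)%:R by rewrite mulr_ge0// ltW.
  have Lo1 : 0 <= L * (1 - (odd c)%:R) by rewrite mulr_ge0 ?(ltW L0)//; lra.
  by split; apply/andP; split; lra.
- apply/trivIsetP => -[i [a c]] [j [a' c']] _ _ neq.
  apply/seteqP; split=> // p [/= Fp Fp']; move/eqP: neq; apply.
  have := disj _ _ _ _ _ Fp Fp'; rewrite /idx/= => -[-> e1 e2].
  have cc : c = c' by apply/val_inj.
  rewrite cc in e1 *; have : a%:Z = a'%:Z by move/addIr : e1.
  by move=> -[/val_inj ->].
Qed.
End TilingBound.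

(** * Regular hexagons *)

Section Hexagon.
Context {R : realType}.
Local Notation plane := (measurableTypeR R * measurableTypeR R)%type.
Implicit Types (p q u v w : plane) (V : seq plane).

(** This is |s + t w|^2 for w = e^(i pi / 3). *)
Definition hexQ (s t : R) : R := s ^+ 2 + s * t + t ^+ 2.

Lemma hexQ_rotate s t : hexQ (s + t) (- s) = hexQ s t.
Proof. by rewrite /hexQ; ring. Qed.

(** Two unit vectors in the same half-open sextant enclose an angle below pi/3, so they are at
    distance less than 1. *)
Lemma hexQ_sector s t s' t' : 0 < s -> 0 <= t -> 0 < s' -> 0 <= t' ->
  hexQ s t = 1 -> hexQ s' t' = 1 -> hexQ (s - s') (t - t') < 1.
Proof.
rewrite /hexQ => s0 t0 s0' t0' st st'.
wlog ts : s t s' t' s0 t0 s0' t0' st st' / s' * t <= s * t' => [wl|].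
  have [|/ltW ts] := leP (s' * t) (s * t'); first exact: wl.
  have := wl s' t' s t s0' t0' s0 t0 st' st ts.
  by rewrite -(sqrrN (s - s')) -(sqrrN (t - t')) -mulrNN !opprB.
have s1 : s <= 1 by nra.
have t1' : t' < 1 by nra.
have d0 : 0 <= s * t' - s' * t by lra.
have d1 : s * t' - s' * t < 1 by nra.
have b0 : 0 <= s * s' + t * t' + (s * t' + s' * t) / 2.
  by rewrite !addr_ge0 ?divr_ge0 ?addr_ge0 ?mulr_ge0// ltW.
(* The inner product and the cross product of two unit vectors have squares adding up to 1. As the
   cross product is below sqrt 3 / 2, the inner product exceeds 1/2. *)
have : (s * s' + t * t' + (s * t' + s' * t) / 2) ^+ 2 + 3 / 4 * (s * t' - s' * t) ^+ 2 = 1.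
  rewrite (_ : _ + _ = (s ^+ 2 + s * t + t ^+ 2) * (s' ^+ 2 + s' * t' + t' ^+ 2)).
    by rewrite st st' mulr1.
  by field.
nra.
Qed.

(* The coordinates of w^(-k) (s + t w), where w = e^(i pi / 3). *)
Definition hex_turn (s t : R) (k : nat) : R * R :=
  iter k (fun c => (c.1 + c.2, - c.1)) (s, t).

(** The number of turns by -60 degrees that bring the vector into the base sextant; [find] returns 6
    when there is none, as for the zero vector. *)
Definition sextant (s t : R) : nat :=
  find (fun k => (0 < (hex_turn s t k).1) && (0 <= (hex_turn s t k).2)) (iota 0 6).

Lemma sextant_lt6 s t : hexQ s t = 1 -> (sextant s t < 6)%N.
Proof.
move=> st; rewrite /sextant -[6%N in X in (_ < X)%N](size_iota 0) -has_find.
apply/negPn/negP => /hasPn notin.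
have turn k : (k < 6)%N -> 0 < (hex_turn s t k).1 -> (hex_turn s t k).2 < 0.
  move=> k6 c1; have := notin k; rewrite mem_iota => /(_ k6).
  by rewrite c1/= -ltNge.
have nz : ~ (s = 0 /\ t = 0).
  by move=> [s0 t0]; move: st; rewrite /hexQ s0 t0 => ?; lra.
move: (turn 0%N isT) (turn 1%N isT) (turn 2%N isT) (turn 3%N isT) (turn 4%N isT)
  (turn 5%N isT) => /= h0 h1 h2 h3 h4 h5.
(* Up to sign, the coordinates of the six turns are s, t and s + t. *)
have [s0|s0|s0] := ltrgtP s 0; have [t0|t0|t0] := ltrgtP t 0;
have [w0|w0|w0] := ltrgtP (s + t) 0; try lra;
  try (by apply: nz);
  first [have := h0 ltac:(lra); lra | have := h1 ltac:(lra); lra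
  | have := h2 ltac:(lra); lra | have := h3 ltac:(lra); lra
  | have := h4 ltac:(lra); lra | have := h5 ltac:(lra); lra].
Qed.

Lemma sextantP s t : hexQ s t = 1 ->
  let c := hex_turn s t (sextant s t) in 0 < c.1 /\ 0 <= c.2.
Proof.
move=> st; have := sextant_lt6 st; rewrite -[6%N](size_iota 0) -has_find => /(nth_find 0%N).
by rewrite nth_iota ?sextant_lt6// add0n => /andP[].
Qed.

Lemma hexQ_turn s t k : hexQ (hex_turn s t k).1 (hex_turn s t k).2 = hexQ s t.
Proof. by elim: k => //= k IH; rewrite hexQ_rotate. Qed.

Lemma hex_turnB s t s' t' k : hex_turn (s - s') (t - t') k =
  ((hex_turn s t k).1 - (hex_turn s' t' k).1, (hex_turn s t k).2 - (hex_turn s' t' k).2).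
Proof. by elim: k => //= k -> /=; congr (_, _); ring. Qed.

Lemma sextant_inj s t s' t' : hexQ s t = 1 -> hexQ s' t' = 1 ->
  sextant s t = sextant s' t' -> hexQ (s - s') (t - t') < 1.
Proof.
move=> st st' e; have [s0 t0] := sextantP st; have [s0' t0'] := sextantP st'.
rewrite -e in s0' t0'; rewrite -(hexQ_turn _ _ (sextant s t)) hex_turnB/=.
by apply: hexQ_sector => //; rewrite hexQ_turn.
Qed.

(** The product (s + t w) v, where w v is [v] turned by 60 degrees. *)
Definition hexcomb v (s t : R) : plane :=
  (s * v.1 + t * (v.1 / 2 - Num.sqrt 3 / 2 * v.2),
   s * v.2 + t * (Num.sqrt 3 / 2 * v.1 + v.2 / 2)).

(** The cross product of [v] and [u] determines t, and their inner product determines s + t / 2. *)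
Definition hexcoord v u : R * R :=
  let t := 2 * (u.2 * v.1 - u.1 * v.2) / (Num.sqrt 3 * normSq v) in
  (dotp u v / normSq v - t / 2, t).

Lemma hexcoordK v u : normSq v != 0 -> hexcomb v (hexcoord v u).1 (hexcoord v u).2 = u.
Proof.
move=> v0; have s3 : Num.sqrt 3 != 0 :> R by rewrite gt_eqF// sqrtr_gt0.
case: u => x y; rewrite /hexcomb /hexcoord /dotp /=.
by rewrite /normSq in v0 *; congr (_, _); field; rewrite v0 s3.
Qed.

Lemma normSq_hexcomb v s t : normSq (hexcomb v s t) = normSq v * hexQ s t.
Proof.
have s3 : Num.sqrt 3 ^+ 2 = 3 :> R by rewrite sqr_sqrtr.
rewrite /normSq /hexcomb /hexQ /=; set r := Num.sqrt 3 in s3 *.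
transitivity ((v.1 ^+ 2 + v.2 ^+ 2) * ((s + t / 2) ^+ 2 + r ^+ 2 / 4 * t ^+ 2)).
  by field.
by rewrite s3; field.
Qed.

Lemma distSq_hexcomb v s t s' t' :
  distSq (hexcomb v s t) (hexcomb v s' t') = normSq v * hexQ (s - s') (t - t').
Proof.
by rewrite -normSq_hexcomb /distSq /normSq /hexcomb/=; ring.
Qed.

(* Each of the six half-open sextants starting at [v] holds at most one vector,
   hence exactly one; the one in the last sextant has to be the turn of [v]. *)
Lemma hexagon_turn V v : size V = 6%N -> all (fun u => normSq u == 3) V ->
  pairwise (fun u w => 3 <= distSq u w) V -> v \in V -> hexcomb v 1 (- 1) \in V.
Proof.
move=> V6 /allP V3 pV vV; have v3 : normSq v = 3 by apply/eqP/V3.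
have v0 : normSq v != 0 by rewrite v3 pnatr_eq0.
have uV : uniq V.
  rewrite uniq_pairwise; apply: sub_pairwise pV => u w /=.
  by apply: contraTneq => ->; rewrite /distSq !subrr expr0n addr0 -ltNge.
pose sx u := sextant (hexcoord v u).1 (hexcoord v u).2.
have Q1 u : u \in V -> hexQ (hexcoord v u).1 (hexcoord v u).2 = 1.
  move=> /V3/eqP; rewrite -{1}(hexcoordK u v0) normSq_hexcomb v3.
  by move=> e; apply: (mulfI (_ : 3 != 0)); rewrite ?mulr1.
have far u w : u \in V -> w \in V -> u != w -> 3 <= distSq u w.
  pose r u w := (u == w) || (3 <= distSq u w).
  have : pairwise r V by apply: sub_pairwise pV => x y; rewrite /r => ->; rewrite orbT.
  rewrite pairwise_all2rel => [/allrelP rV uV' wV|x|x y]; last 2 first.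
  - by rewrite /r eqxx.
  - by rewrite /r eq_sym /distSq -(sqrrN (x.1 - y.1)) -(sqrrN (x.2 - y.2)) !opprB.
  by have := rV _ _ uV' wV; rewrite /r => /orP[->|].
have sxI : {in V &, injective sx}.
  move=> u w uV' wV e; apply/eqP/negP => /negP/(far _ _ uV' wV).
  have := sextant_inj (Q1 _ uV') (Q1 _ wV) e.
  rewrite (_ : distSq u w = 3 * hexQ ((hexcoord v u).1 - (hexcoord v w).1)
    ((hexcoord v u).2 - (hexcoord v w).2)); first lra.
  by rewrite -v3 -distSq_hexcomb !hexcoordK.
have : 5%N \in map sx V.
  have sub : {subset map sx V <= iota 0 6}.
    by move=> _ /mapP[u uV' ->]; rewrite mem_iota/= sextant_lt6// Q1.
  have [||_ ->] // := uniq_min_size _ sub; first by rewrite map_inj_in_uniq.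
  by rewrite size_map V6.
move=> /mapP[u uV' u5].
have := sextantP (Q1 _ uV'); rewrite -/(sx u) -u5.
move: (hexcoordK u v0) (Q1 _ uV').
case: (hexcoord v u) => s t /= uE Qu [c1 c2].
have vE : hexcomb v 1 0 = v by case: (v) => x y; rewrite /hexcomb/=; congr (_, _); ring.
have uv : u != v.
  apply/eqP => uv; move: u5; rewrite uv /sx.
  rewrite (_ : hexcoord v v = (1, 0)); last first.
    rewrite /hexcoord /dotp -!expr2 -/(normSq v) divff//.
    by rewrite [v.2 * _]mulrC subrr mulr0 mul0r mul0r subr0.
  by rewrite /sextant/= ltr01 lexx.
have := far _ _ uV' vV uv; rewrite -uE -[X in distSq _ X]vE distSq_hexcomb v3 subr0.
move: Qu; rewrite /hexQ => Qu Quv.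
(* Let a = s + t >= 0 and b = -t > 0. Then a^2 + a b + b^2 = 1, and the distance to [v] gives 2 a +
   b <= 1. Squaring and subtracting yields a^2 + a b <= 0, whence a = 0 and b = 1. *)
have tn : 0 < - t by lra.
have w0 : 0 <= s + t by lra.
have lin : 2 * (s + t) + - t <= 1 by lra.
have sq : (2 * (s + t) + - t) ^+ 2 <= 1 by rewrite expr_le1//; lra.
have wt : 0 <= (s + t) * - t by rewrite mulr_ge0// ltW.
have t0 : s + t = 0.
  apply/eqP; rewrite -sqrf_eq0; apply/eqP/le_anti; rewrite sqr_ge0 andbT.
  by lra.
have sE : s = - t by lra.
have t1 : t = - 1.
  have : (- t - 1) * (- t + 1) = 0 by rewrite sE in Qu; lra.
  by move/eqP; rewrite mulf_eq0 => /orP[] /eqP; lra.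
by rewrite (_ : s = 1) ?t1 in uE; [rewrite uE|lra].
Qed.
End Hexagon.

(** * Tight packings *)

Lemma finite_int_square (K : nat) :
  finite_set [set m : int * int | (`|m.1| <= K)%N /\ (`|m.2| <= K)%N].
Proof.
pose f (t : 'I_(2 * K).+1 * 'I_(2 * K).+1) : int * int :=
  ((t.1 : nat)%:Z - K%:Z, (t.2 : nat)%:Z - K%:Z).
apply: (@sub_finite_set _ _ (f @` setT)); last exact/finite_image/finite_finset.
move=> [m k] /= [mK kK].
have m1 : (absz (m + K%:Z)%R < (2 * K).+1)%N by lia.
have k1 : (absz (k + K%:Z)%R < (2 * K).+1)%N by lia.
exists (Ordinal m1, Ordinal k1) => //; rewrite /f/=; congr (_, _); lia.
Qed.

Section Tight.
Context {R : realType}.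
Local Notation plane := (measurableTypeR R * measurableTypeR R)%type.
Implicit Types (u v w x y : plane) (V : seq plane).

Definition vadd x v : plane := (x.1 + v.1, x.2 + v.2).
Definition vsub x y : plane := (x.1 - y.1, x.2 - y.2).

Lemma round_int (x : R) : exists a : int, `|x - a%:~R| <= 1 / 2.
Proof.
exists (Num.floor (x + 1 / 2)); rewrite ler_norml.
have := ge_floor (x + 1 / 2); have := floorD1_gt (x + 1 / 2).
by rewrite intrD1 => ? ?; apply/andP; split; lra.
Qed.

Lemma sum_sqr_lt1 (a b : R) : a ^+ 2 + b ^+ 2 < 1 -> `|a| <= 1 /\ `|b| <= 1.
Proof. by move=> ab; split; rewrite ler_norml; apply/andP; split; nra. Qed.

(** * Separated sets of centres, periodic under a triangular lattice *)

Variables (n : nat) (L : R) (p : 'I_n -> plane).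
Let H := L * (Num.sqrt 3 / 2).
Hypothesis L0 : 0 < L.
Let pt i (l : int * int) : plane := vadd (p i) (lat L H l).
Hypothesis sep : forall i j l m,
  (i, l) <> (j, m) -> 3 <= distSq (pt i l) (pt j m).

Let H0 : 0 < H. Proof. by rewrite mulr_gt0// divr_gt0// sqrtr_gt0. Qed.

Lemma latD l m : lat L H (l + m) = vadd (lat L H l) (lat L H m).
Proof. by rewrite /lat /vadd/= !rmorphD/=; congr (_, _); ring. Qed.

Lemma latN l : lat L H (- l) = (- (lat L H l).1, - (lat L H l).2).
Proof. by rewrite /lat/= !rmorphN/=; congr (_, _); ring. Qed.

(** A bounded displacement bounds [m.2], hence also [m.1], so finitely many indices are relevant. *)
Lemma neighbour_list i : exists V : seq plane, uniq V /\ forall v, v \in V <->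
  normSq v < 4 /\ exists j m, (j, m) <> (i, 0) /\ v = vsub (pt j m) (p i).
Proof.
pose M := \sum_j (`|(p j).1| + `|(p j).2|).
have pM j : `|(p j).1| <= M /\ `|(p j).2| <= M.
  rewrite /M (bigD1 j)//=; set S := \sum_(_ < _ | _) _.
  have : 0 <= S by apply: sumr_ge0 => k _; rewrite addr_ge0.
  by have := normr_ge0 (p j).1; have := normr_ge0 (p j).2; split; lra.
pose Q := 2 + 2 * M; pose K := Num.bound (Q / L + Q / H).
pose f (t : 'I_n * (int * int)) : plane := vsub (pt t.1 t.2) (p i).
pose S := [set v : plane | normSq v < 4 /\
  exists j m, (j, m) <> (i, 0) /\ v = vsub (pt j m) (p i)].
have /finite_seqP[V SV] : finite_set S.
  apply: (@sub_finite_set _ _ (f @` (setT `*`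
    [set m : int * int | (`|m.1| <= K)%N /\ (`|m.2| <= K)%N]))); last first.
    by apply/finite_image/finite_setX; [exact: finite_finset|exact: finite_int_square].
  move=> v [v4 [j [m [_ vE]]]]; exists (j, m) => //; split=> //=.
  have [pi1 pi2] := pM i; have [pj1 pj2] := pM j.
  have absK (k : int) : `|k%:~R| < K%:R :> R -> (`|k| <= K)%N.
    by rewrite -intr_norm -abszE -pmulrn ltr_nat => /ltnW.
  rewrite /normSq in v4.
  have v2 : `|v.2| <= 2 by rewrite ler_norml; apply/andP; split; nra.
  have v1 : `|v.1| <= 2 by rewrite ler_norml; apply/andP; split; nra.
  have Q0 : 0 <= Q by rewrite /Q; have := normr_ge0 (p i).1; lra.
  have QL : 0 <= Q / L by rewrite divr_ge0// ltW.
  have QH : 0 <= Q / H by rewrite divr_ge0// ltW.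
  have QK : Q / L + Q / H < K%:R by apply: archi_boundP; exact: addr_ge0.
  have m2Q : `|m.2%:~R| <= Q / H :> R.
    rewrite ler_pdivlMr// -[X in _ * X <= _](gtr0_norm H0) -normrM.
    rewrite (_ : _ * H = v.2 - (p j).2 + (p i).2); last by rewrite vE /=; ring.
    rewrite (le_trans (ler_normD _ _))// (le_trans (lerD (ler_normB _ _) pi2))//.
    by rewrite /Q; lra.
  have m1Q : `|m.1%:~R| <= Q / L + Q / H :> R.
    have : `|m.1%:~R + m.2%:~R / 2| <= Q / L :> R.
      rewrite ler_pdivlMr// -[X in _ * X <= _](gtr0_norm L0) -normrM.
      rewrite (_ : _ * L = v.1 - (p j).1 + (p i).1); last by rewrite vE /=; ring.
      rewrite (le_trans (ler_normD _ _))// (le_trans (lerD (ler_normB _ _) pi1))//.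
      by rewrite /Q; lra.
    rewrite ler_norml => /andP[? ?]; move: m2Q; rewrite ler_norml => /andP[? ?].
    by rewrite ler_norml; apply/andP; split; lra.
  by split; apply: absK; lra.
exists (undup V); rewrite undup_uniq; split=> // v; rewrite mem_undup.
by have -> : v \in V <-> S v by rewrite SV.
Qed.

Definition lists_neighbours i V := uniq V /\ forall v, v \in V <->
  normSq v < 4 /\ exists j m, (j, m) <> (i, 0) /\ v = vsub (pt j m) (p i).

Lemma pt0 i : pt i 0 = p i.
Proof. by rewrite /pt /vadd /lat/= !mulr0 !addr0; case: (p i). Qed.

Lemma ptD i l m : pt i (l + m) = vadd (pt i l) (lat L H m).
Proof. by rewrite /pt latD /vadd/=; congr (_, _); ring. Qed.

Lemma distSq_vsub x y z : distSq (vsub x z) (vsub y z) = distSq x y.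
Proof. by rewrite /distSq /vsub/=; congr (_ ^+ 2 + _ ^+ 2); ring. Qed.

Lemma normSq_vsub x y : normSq (vsub x y) = distSq x y.
Proof. by []. Qed.

Lemma neighbours_lists i V : lists_neighbours i V -> neighbours V.
Proof.
move=> [uV VE]; apply/andP; split.
  apply/allP => v /VE[v4 [j [m [ne vE]]]]; rewrite v4 andbT vE normSq_vsub -pt0.
  exact: sep.
move: uV; rewrite uniq_pairwise; apply: (@sub_in_pairwise _ (mem V)); last exact/allP.
move=> v w /VE[_ [j [m [_ ->]]]] /VE[_ [k [l [_ ->]]]]/= vw.
rewrite distSq_vsub; apply: sep => e; move/eqP: vw; apply.
by case: e => -> ->.
Qed.

(** By the parallelogram law, a point at distance less than 1 from two centres forces these to be
    less than 2 apart. Each is thus a neighbour of the other, and the cell condition compares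
    them. *)
Lemma cell_closer i V l j m q : lists_neighbours i V -> (i, l) <> (j, m) ->
  normSq (vsub q (pt i l)) < 1 -> normSq (vsub q (pt j m)) < 1 ->
  (forall v, v \in V -> 2 * dotp (vsub q (pt i l)) v < normSq v) ->
  2 * dotp (vsub q (pt i l)) (vsub (pt j m) (pt i l)) < distSq (pt j m) (pt i l).
Proof.
move=> [_ VE] ne qi qj qV; apply: qV; apply/VE; split.
  have : 0 <= normSq (vadd (vsub q (pt i l)) (vsub q (pt j m))).
    by rewrite /normSq addr_ge0 ?sqr_ge0.
  by move: qi qj; rewrite /normSq /vadd /vsub/=; lra.
exists j, (m - l); split.
  move=> e; have /= ji := congr1 fst e; have /= ml := congr1 snd e.
  by apply: ne; rewrite ji -(subrK l m) ml add0r.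
by rewrite ptD latN -(pt0 i) -{1}(add0r l) ptD /vsub /vadd/=; congr (_, _); ring.
Qed.

(** The n cells have area at least 3 sqrt 3 / 2 each and at most L H = n (3 sqrt 3 / 2) in all, so
    each bound is attained. *)
Lemma cells_tight (V : 'I_n -> seq plane) : L ^+ 2 = 3 * n%:R ->
  (forall i, lists_neighbours i (V i)) ->
  forall i, size (V i) = 6%N /\ all (fun v => normSq v == 3) (V i).
Proof.
move=> Ln VE; have nV i := neighbours_lists (VE i).
have /choice[b bE] i : exists a : R, area (cell (V i)) = a%:E /\
    (3 * Num.sqrt 3 / 2 <= a /\ (a = 3 * Num.sqrt 3 / 2 ->
      size (V i) = 6%N /\ all (fun v => normSq v == 3) (V i))).
  by have [a ? ?] := area_cell (nV i); exists a.
pose B i : set plane :=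
  (fun q : plane => (q.1 + - (p i).1, q.2 + - (p i).2)) @^-1` cell (V i).
pose M := 1 + \sum_j (`|(p j).1| + `|(p j).2|).
have sumb : \sum_i b i <= L * H.
  apply: (@packing_area_le _ L H n B b M L0 H0).
  - by move=> i; apply: measurable_preimage_translate; exact: measurable_cell.
  - by move=> i; rewrite area_translate; [case: (bE i)|exact: measurable_cell].
  - move=> i [x y] [/=]; rewrite /normSq/= => q1 _.
    have [x1 y1] := sum_sqr_lt1 q1.
    have xM := ler_normD (x - (p i).1) (p i).1; rewrite subrK in xM.
    have yM := ler_normD (y - (p i).2) (p i).2; rewrite subrK in yM.
    rewrite /M (bigD1 i)//=; set S := \sum_(_ < _ | _) _.
    have S0 : 0 <= S by apply: sumr_ge0 => k _; rewrite addr_ge0.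
    have p10 := normr_ge0 (p i).1; have p20 := normr_ge0 (p i).2.
    by split; lra.
  - move=> i j l m q Bi Bj; apply/eqP/negPn/negP => /eqP ne.
    have toB k r : B k (q.1 - (lat L H r).1, q.2 - (lat L H r).2) ->
        cell (V k) (vsub q (pt k r)).
      rewrite /B/preimage/mkset/=; congr (cell (V k) _).
      by rewrite /vsub /pt /vadd/=; congr (_, _); ring.
    have [qi ci] := toB _ _ Bi; have [qj cj] := toB _ _ Bj.
    (* A common point would be strictly closer to each centre than to the other. *)
    have := cell_closer (VE i) ne qi qj ci.
    have := cell_closer (VE j) (not_eq_sym ne) qj qi cj.
    have := sep ne; rewrite /dotp /normSq /distSq /vsub/=; lra.
have n0 i : 0 <= b i - 3 * Num.sqrt 3 / 2 by rewrite subr_ge0; case: (bE i) => _ [].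
have s0 : \sum_i (b i - 3 * Num.sqrt 3 / 2) == 0.
  rewrite eq_le sumr_ge0// andbT sumrB sumr_const card_ord subr_le0.
  rewrite (le_trans sumb)// /H mulrA -expr2 Ln -[X in _ <= X]mulr_natl; lra.
move=> i; have [_ [_]] := bE i; apply.
have := s0; rewrite psumr_eq0// => /allP/(_ i).
by rewrite mem_index_enum => /(_ isT)/=; rewrite subr_eq0 => /eqP.
Qed.

(** * Propagation of contacts in a tight packing *)

Definition site x := exists i l, x = pt i l.
Definition bond x v := [/\ site x, site (vadd x v) & normSq v = 3].
Definition vscale (a : R) v : plane := (a * v.1, a * v.2).
(* [v] turned by -60 degrees *)
Definition vturn v : plane := hexcomb v 1 (- 1).

Lemma vturn3 v : vturn (vturn (vturn v)) = vscale (- 1) v.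
Proof.
have s3 : Num.sqrt 3 ^+ 2 = 3 :> R by rewrite sqr_sqrtr.
rewrite /vturn /vscale /hexcomb/=; set r := Num.sqrt 3 in s3 *.
have s33 : r ^+ 3 = 3 * r by rewrite exprS s3; ring.
by congr (_, _); field: s3 s33.
Qed.

Hypothesis Ln : L ^+ 2 = 3 * n%:R.

(** After a lattice translation, [v] is one of the six tight neighbours of some [p i], and these are
    closed under turns by [hexagon_turn]. *)
Lemma bond_turn x v : bond x v -> bond x (vturn v).
Proof.
move=> [[i [l xE]] [j [m yE]] v3].
have [V VE] : {V : 'I_n -> seq plane & forall i, lists_neighbours i (V i)}.
  by apply: choice => k; exact: neighbour_list.
have [V6 V3] := cells_tight Ln VE i.
have /andP[_ pV] := neighbours_lists (VE i).
have vE : v = vsub (pt j (m - l)) (p i).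
  have <- : vsub (vadd x v) x = v.
    by case: (v) => a b; rewrite /vsub /vadd/=; congr (_, _); ring.
  by rewrite yE xE ptD latN /vsub /vadd/= /pt /vadd/=; congr (_, _); ring.
have vV : v \in V i.
  apply/(VE i).2; split; first by rewrite v3; lra.
  exists j, (m - l); split=> // e.
  move: v3; rewrite vE; have /= -> := congr1 fst e; have /= -> := congr1 snd e.
  by rewrite pt0 /normSq /vsub/= !subrr expr0n addr0 => /eqP; rewrite eqr_nat.
have := hexagon_turn V6 V3 pV vV; rewrite -/(vturn v) => tV.
split; first by exists i, l.
  have [_ [k [r [_ ->]]]] := ((VE i).2 _).1 tV.
  exists k, (r + l); rewrite xE ptD /vadd /vsub/= /pt /vadd/=; congr (_, _); ring.
by apply/eqP/(allP V3).
Qed.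

Lemma bond_opp x v : bond x v -> bond x (vscale (- 1) v).
Proof. by rewrite -vturn3 => /bond_turn/bond_turn/bond_turn. Qed.

Lemma vscaleN1K v : vscale (- 1) (vscale (- 1) v) = v.
Proof. by case: v => a b; rewrite /vscale/= !mulN1r !opprK. Qed.

(** Seen from x + v, the centre x gives the bond -v; half a turn there makes it v. *)
Lemma bond_step x v : bond x v -> bond (vadd x v) v.
Proof.
move=> [sx sxv v3]; rewrite -[X in bond _ X]vscaleN1K; apply: bond_opp; split=> //.
  rewrite (_ : vadd _ _ = x)//; case: (x) => a b.
  by rewrite /vadd/vscale/=; congr (_, _); ring.
by rewrite -v3 /normSq /vscale/=; ring.
Qed.

Lemma bond_walk x v (a : int) : bond x v -> bond (vadd x (vscale a%:~R v)) v.
Proof.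
have walk w k y : bond y w -> bond (vadd y (vscale k%:R w)) w.
  elim: k => [|k IH] yw.
    rewrite (_ : vadd _ _ = y)//; case: (y) => c d.
    by rewrite /vadd/vscale/= !mul0r !addr0.
  have := bond_step (IH yw); congr (bond _ _).
  by rewrite /vadd /vscale/= -natr1; congr (_, _); ring.
case: a => k xv; first exact: walk.
(* A negative integer [Negz k] stands for k + 1 steps along the opposite bond. *)
have := bond_opp (walk _ k.+1 _ (bond_opp xv)); rewrite vscaleN1K; congr (bond _ _).
by rewrite /vadd /vscale/= NegzE rmorphN/= -pmulrn; congr (_, _); ring.
Qed.

(** Since [vturn v] is v - w v, walking a + b steps along v and -b steps along [vturn v] adds a v +
    b w v. *)
Lemma site_hexcomb x v (a b : int) : bond x v -> site (vadd x (hexcomb v a%:~R b%:~R)).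
Proof.
move=> /(bond_walk (a + b))/bond_turn/(bond_walk (- b))[+ _ _].
congr (site _); rewrite /vturn /vadd /vscale /hexcomb/= rmorphN rmorphD/=.
by congr (_, _); ring.
Qed.

Lemma site_far x y : site x -> site y -> x <> y -> 3 <= distSq x y.
Proof.
move=> [i [l ->]] [j [m ->]] ne; apply: sep => e; apply: ne.
by case: e => -> ->.
Qed.

Theorem loeschian_of_tight : (0 < n)%N ->
  exists a b : int, n%:Z = a ^+ 2 + a * b + b ^+ 2.
Proof.
move=> n0; pose i := Ordinal n0.
have [V VE] : {V : 'I_n -> seq plane & forall i, lists_neighbours i (V i)}.
  by apply: choice => k; exact: neighbour_list.
have [V6 V3] := cells_tight Ln VE i.
have [v vV] : exists v, v \in V i.
  by case: (V i) V6 => // v s _; exists v; rewrite mem_head.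
have v3 : normSq v = 3 by apply/eqP/(allP V3).
have sp : site (p i) by exists i, 0; rewrite pt0.
have xv : bond (p i) v.
  split=> //; have [_ [j [m [_ vE]]]] := ((VE i).2 _).1 vV.
  exists j, m; rewrite vE; case: (pt j m) (p i) => [a b] [c d].
  by rewrite /vadd /vsub/=; congr (_, _); ring.
pose c := hexcoord v (L, 0).
have cE : hexcomb v c.1 c.2 = (L, 0) by apply: hexcoordK; rewrite v3 pnatr_eq0.
have [a ca] := round_int c.1; have [b cb] := round_int c.2.
have sL : site (vadd (p i) (L, 0)).
  by exists i, (1, 0); rewrite /pt /lat/= !mulr0 mulr1 addr0.
have sab := site_hexcomb a b xv.
(* Rounding errors e and f of at most 1/2 give e^2 + e f + f^2 <= 3/4, hence a squared distance of
   at most 9/4. Two centres that close coincide. *)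
have near : distSq (vadd (p i) (L, 0)) (vadd (p i) (hexcomb v a%:~R b%:~R)) < 3.
  rewrite (_ : distSq _ _ = distSq (hexcomb v c.1 c.2) (hexcomb v a%:~R b%:~R)).
    rewrite distSq_hexcomb v3 /hexQ.
    move: ca cb; rewrite !ler_norml; set e := c.1 - _; set f := c.2 - _ => ee ff.
    have : e ^+ 2 <= 1 / 4 by nra.
    have : f ^+ 2 <= 1 / 4 by nra.
    by have := sqr_ge0 (e - f); lra.
  by rewrite cE /distSq /vadd/=; ring.
have same : vadd (p i) (L, 0) = vadd (p i) (hexcomb v a%:~R b%:~R).
  by apply: contrapT => /(site_far sL sab); rewrite leNgt near.
have Lab : (L, 0) = hexcomb v a%:~R b%:~R.
  by case: same => /addrI e1 /addrI e2; rewrite /hexcomb; congr (_, _).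
exists a, b; apply: (@intr_inj R); rewrite -pmulrn.
have : normSq ((L, 0) : plane) = 3 * hexQ a%:~R b%:~R.
  by rewrite Lab normSq_hexcomb v3.
have n3 : 3 != 0 :> R by rewrite pnatr_eq0.
rewrite /normSq/= expr0n addr0 Ln => /(mulfI n3) ->.
by rewrite /hexQ !rmorphD/= !rmorphXn/= rmorphM.
Qed.
End Tight.

(** * Residues modulo n1 + n2 w *)

Lemma hexZ_gt0 (a b : int) : (a, b) != (0, 0) -> 1 <= a ^+ 2 + a * b + b ^+ 2.
Proof.
move=> ab; have [a0|a0] := eqVneq a 0.
  have b0 : b != 0 by apply: contraNneq ab => ->; rewrite a0.
  by nia.
by nia.
Qed.

Lemma eq0_of_small_multiple (d : nat) (x : int) : `|d%:Z * x| < d%:Z -> x = 0.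
Proof.
move=> dx; apply/eqP/negPn/negP => x0; move: dx; rewrite normrM ltNge ler_peMr//.
by rewrite -gtz0_ge1 normr_gt0.
Qed.

Lemma distz_lt (x y d : nat) : (x < d)%N -> (y < d)%N -> `|x%:Z - y%:Z| < d%:Z.
Proof. lia. Qed.

(** As w^2 = w - 1, the right-hand sides are the coordinates of (k + l w)(n1 + n2 w). With g = gcd
    (n1, n2), the representatives are x + y w for 0 <= x < n / g and 0 <= y < g, enumerated by i = x
    g + y. *)
Lemma eisenstein_residues (n1 n2 : int) (n : nat) : (0 < n)%N ->
  n%:Z = n1 ^+ 2 + n1 * n2 + n2 ^+ 2 ->
  exists f : 'I_n -> int * int, forall i j (k l : int),
    (f i).1 - (f j).1 = k * n1 - l * n2 ->
    (f i).2 - (f j).2 = k * n2 + l * (n1 + n2) -> i = j.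
Proof.
move=> n0 nE; pose g := gcdn `|n1| `|n2|.
have g0 : (0 < g)%N.
  rewrite gcdn_gt0; apply/negPn/negP; rewrite negb_or -!leqNgt !leqn0 !absz_eq0.
  by move=> /andP[/eqP n10 /eqP n20]; move: nE n0; rewrite n10 n20; lia.
have [a aE] : exists a, n1 = g%:Z * a.
  by have /dvdzP[a ->] : (g%:Z %| n1)%Z := dvdn_gcdl _ _; exists a; rewrite mulrC.
have [b bE] : exists b, n2 = g%:Z * b.
  by have /dvdzP[b ->] : (g%:Z %| n2)%Z := dvdn_gcdr _ _; exists b; rewrite mulrC.
have gZ : g%:Z != 0 by lia.
have [u [v uv]] : exists u v, u * b + v * (a + b) = 1.
  have [u [v uv]] := Bezoutz n1 n2.
  exists (v - u), u; apply: (mulfI gZ).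
  by move: uv; rewrite aE bE /gcdz -aE -bE -/g; lia.
pose N : int := a ^+ 2 + a * b + b ^+ 2.
have nN : n%:Z = g%:Z * g%:Z * N by rewrite nE aE bE /N; ring.
exists (fun i => ((i %/ g)%N%:Z, (i %% g)%N%:Z)) => i j k l /= dx dy.
have iE := divn_eq i g; have jE := divn_eq j g.
have yi := ltn_pmod i g0; have yj := ltn_pmod j g0.
move: dx dy iE jE yi yj; set xi := (i %/ g)%N; set xj := (j %/ g)%N.
set yi := (i %% g)%N; set yj := (j %% g)%N => dx dy iE jE yi_lt yj_lt.
pose E := k * b + l * (a + b).
have dyE : yi%:Z - yj%:Z = g%:Z * E by rewrite dy aE bE /E; ring.
have E0 : E = 0.
  by apply: (@eq0_of_small_multiple g); rewrite -dyE; exact: distz_lt.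
have yy : yi%:Z = yj%:Z by apply/eqP; rewrite -subr_eq0 dyE E0 mulr0.
(* As [E] vanishes and b, a + b are coprime, (k, l) is s times (a + b, -b); thus k a - l b = N s,
   and i - j is a multiple of n. *)
pose s := v * k - u * l.
have Ds : k * a - l * b = N * s.
  have : (k * a - l * b) * (u * b + v * (a + b)) - N * s = (u * a - v * b) * E.
    by rewrite /E /N /s; ring.
  by rewrite uv E0 mulr1 mulr0 => /eqP; rewrite subr_eq0 => /eqP.
have ij : (i : nat)%:Z - (j : nat)%:Z = n%:Z * s.
  rewrite nN iE jE !PoszD !PoszM yy.
  have -> : xi%:Z * g%:Z + yj%:Z - (xj%:Z * g%:Z + yj%:Z) =
    (xi%:Z - xj%:Z) * g%:Z by ring.
  by rewrite dx aE bE -[_ * N * s]mulrA -Ds; ring.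
have s0 : s = 0.
  by apply: (@eq0_of_small_multiple n); rewrite -ij; exact: distz_lt.
by apply/val_inj; move/eqP: ij; rewrite s0 mulr0 subr_eq0 => /eqP[].
Qed.

(** * Disks in the complex plane *)

Local Open Scope complex_scope.

Section Disks.
Context {R : realType}.
Implicit Types (a b w : R[i]) (r : R).

(** The squared modulus as an element of [R], whereas the norm of [R[i]] takes values in [R[i]]. *)
Definition csq w : R := complex.Re w ^+ 2 + complex.Im w ^+ 2.

Lemma csq_ge0 w : 0 <= csq w.
Proof. by rewrite addr_ge0 ?sqr_ge0. Qed.

Lemma norm_csq w : `|w| = (Num.sqrt (csq w))%:C.
Proof. exact: normc_def. Qed.

Lemma ler_norm_csq r w : 0 <= r -> (r%:C <= `|w|) = (r ^+ 2 <= csq w).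
Proof.
move=> r0; rewrite norm_csq lecR -{1}(ger0_norm r0) -sqrtr_sqr ler_sqrt//.
exact: csq_ge0.
Qed.

Lemma csqM a b : csq (a * b) = csq a * csq b.
Proof. by case: a b => [a1 a2] [b1 b2]; rewrite /csq /=; ring. Qed.

Lemma csq_gt0 w : (0 < csq w) = (w != 0).
Proof.
rewrite lt_neqAle csq_ge0 andbT eq_sym; congr (~~ _); case: w => x y.
by rewrite /csq/= paddr_eq0 ?sqr_ge0// !sqrf_eq0 eq_complex.
Qed.

(** If the centres are too close, their midpoint is interior to both disks. Conversely, a common
    interior point is at distance at least r from [a], and moving it slightly away from [a] leaves
    the disk. *)
Lemma interior_disk a b r : 0 < r ->
  interior (disk a r) `&` interior (disk b r) = set0 <-> (2 * r) ^+ 2 <= csq (a - b).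
Proof.
move=> r0; rewrite -ler_norm_csq; last by rewrite mulr_ge0// ltW.
have rC : 0 < r%:C by rewrite ltcR.
have r2 : (2 * r)%:C = r%:C + r%:C by rewrite -rmorphD/=; congr (_%:C); ring.
rewrite r2.
split=> [disj|ab].
  have ball_in d w : `|w - d| < r%:C -> interior (disk d r) w.
    move=> wd; apply/nbhs_ballP; exists (r%:C - `|w - d|); rewrite /= ?subr_gt0//.
    move=> w'; rewrite -ball_normE /= ltrBrDr => ww'; rewrite /disk/=.
    have -> : w' - d = - (w - w') + (w - d) by ring.
    by rewrite (le_trans (ler_normD _ _))// normrN ltW.
  rewrite real_leNgt ?normr_real ?realD ?gtr0_real//; apply/negP => ab.
  have half d : `|d| < r%:C + r%:C -> `|d / 2| < r%:C.
    by rewrite normrM normfV normr_nat ltr_pdivrMr// mulr_natr mulr2n.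
  have : (interior (disk a r) `&` interior (disk b r)) ((a + b) / 2).
    split; apply: ball_in.
      have -> : (a + b) / 2 - a = (b - a) / 2 by field.
      by apply: half; rewrite distrC.
    have -> : (a + b) / 2 - b = (a - b) / 2 by field.
    exact: half.
  by rewrite disj.
apply/seteqP; split=> // w [/= wa wb].
have wb1 : `|w - b| <= r%:C by exact: (interior_subset wb).
have wa1 : r%:C <= `|w - a|.
  rewrite -(lerD2r `|w - b|) (le_trans _ (le_trans ab _))//.
    by rewrite lerD2l.
  have -> : a - b = - (w - a) + (w - b) by ring.
  by rewrite (le_trans (ler_normD _ _))// normrN.
move/nbhs_ballP: wa => [e /= e0 ewa].
have N0 : 0 < `|w - a| by exact: lt_le_trans wa1.
(* This moves [w] by exactly e / 2, within the ball of radius [e]. *)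
pose t := e / 2 / `|w - a|.
have t0 : 0 < t by rewrite !divr_gt0.
have : disk a r (w + t * (w - a)).
  apply: ewa; rewrite -ball_normE/= opprD addrA subrr sub0r normrN normrM (gtr0_norm t0).
  by rewrite divfK ?gt_eqF// ltr_pdivrMr// ltr_pMr// ltr1n.
rewrite /disk/=; have -> : w + t * (w - a) - a = (1 + t) * (w - a) by ring.
rewrite normrM gtr0_norm ?addr_gt0// => wt.
have : `|w - a| <= r%:C by apply: le_trans wt; rewrite ler_peMl// lerDl ltW.
move=> waE; have {waE} waE : `|w - a| = r%:C by apply/le_anti; rewrite waE wa1.
by move: wt; rewrite waE ger_pMl// gerDl; rewrite lt_geF.
Qed.
End Disks.

(** * Triangular tori *)

Section Main.
Context {R : realType}.
Implicit Types (z w : R[i]).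

(** The torus has area |z|^2 sqrt 3 / 2. Once pi and sqrt 3 cancel, optimal density means |z / (2
    r)|^2 = n. *)
Lemma triangular_density z n (r : R) : z != 0 ->
  torus_density z (g_triangle R * z) n r = delta_triangle R <->
  csq z = 4 * n%:R * r ^+ 2.
Proof.
move=> z0; have c0 : 0 < csq z by rewrite csq_gt0.
have s0 : 0 < Num.sqrt 3 :> R by rewrite sqrtr_gt0.
have s3 : Num.sqrt 3 ^+ 2 = 3 :> R by rewrite sqr_sqrtr.
have p0 := @pi_gt0 R.
have s12 : Num.sqrt 12 = 2 * Num.sqrt 3 :> R.
  have -> : 12 = 2 ^+ 2 * 3 :> R by ring.
  by rewrite sqrtrM ?sqr_ge0// sqrtr_sqr ger0_norm.
have area : torus_area z (g_triangle R * z) = csq z * (Num.sqrt 3 / 2).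
  rewrite /torus_area (_ : complex.Im _ = csq z * (Num.sqrt 3 / 2)).
    by rewrite ger0_norm// mulr_ge0 ?divr_ge0// ltW.
  by case: (z) => x y; rewrite /csq /g_triangle/=; field.
rewrite /torus_density /delta_triangle area s12.
have d0 : csq z * (Num.sqrt 3 / 2) != 0 by rewrite gt_eqF// mulr_gt0 ?divr_gt0.
have e0 : 2 * Num.sqrt 3 != 0 :> R by rewrite gt_eqF// mulr_gt0.
split=> [/eqP|e].
  rewrite eqr_div// => /eqP e.
  have q0 : pi * Num.sqrt 3 != 0 :> R by rewrite gt_eqF// mulr_gt0.
  by apply: (mulfI q0); lra.
by apply/eqP; rewrite eqr_div// e; apply/eqP; field.
Qed.

Lemma lattice_ptE z (m : int * int) :
  lattice_pt z (g_triangle R * z) m = lattice_pt 1 (g_triangle R) m * z.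
Proof. by rewrite /lattice_pt mulr1 mulrDl mulrA. Qed.

Lemma unit_lattice_ptE (m : int * int) : lattice_pt 1 (g_triangle R) m =
  (m.1%:~R + m.2%:~R / 2) +i* (m.2%:~R * (Num.sqrt 3 / 2)).
Proof.
apply/eqP; rewrite eq_complex /lattice_pt /g_triangle mulr1.
have -> : m.2%:~R = (m.2%:~R : R)%:C :> R[i] by rewrite rmorph_int.
have -> : m.1%:~R = (m.1%:~R : R)%:C :> R[i] by rewrite rmorph_int.
by rewrite /=; apply/andP; split; apply/eqP; field.
Qed.

(** Packings distinguish lifts by lattice vectors, tight sets of centres by integer coordinates;
    injectivity passes from one to the other. *)
Lemma lattice_pt_inj z : z != 0 -> injective (lattice_pt z (g_triangle R * z)).
Proof.
move=> z0 [a b] [a' b']; rewrite !lattice_ptE => /(mulIf z0); rewrite !unit_lattice_ptE.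
have s0 : Num.sqrt 3 / 2 != 0 :> R by rewrite gt_eqF// divr_gt0// sqrtr_gt0.
by case=> + /(mulIf s0)/intr_inj bb; rewrite bb => /addIr/intr_inj ->.
Qed.

(** Division by z followed by the factor sqrt (3 n) = |z| sqrt 3 / (2 r) turns the minimal distance
    2 r between centres into sqrt 3. *)
Lemma loeschian_of_packing n z (c : 'I_n -> R[i]) (r : R) : (0 < n)%N -> z != 0 ->
  is_torus_packing (lattice z (g_triangle R * z)) c r ->
  csq z = 4 * n%:R * r ^+ 2 ->
  exists n1 n2 : int, n%:Z = n1 ^+ 2 + n1 * n2 + n2 ^+ 2.
Proof.
move=> n0 z0 [r0 pack] zE.
have nR : 0 < n%:R :> R by rewrite ltr0n.
(* rescaled so that the disks become unit disks and z a positive real *)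
pose L : R := Num.sqrt (3 * n%:R).
have L2 : L ^+ 2 = 3 * n%:R by rewrite sqr_sqrtr// mulr_ge0// ltW.
have L0 : 0 < L by rewrite sqrtr_gt0 mulr_gt0.
pose p (i : 'I_n) : R * R := (L * complex.Re (c i / z), L * complex.Im (c i / z)).
apply: (@loeschian_of_tight R n L p L0 _ L2 n0) => i j l m ne.
have ne' : (i, lattice_pt z (g_triangle R * z) l) <>
    (j, lattice_pt z (g_triangle R * z) m).
  by move=> [ij /(lattice_pt_inj z0) lm]; apply: ne; rewrite ij lm.
have /(interior_disk _ _ r0) := pack _ _ _ _ (imageT _ l) (imageT _ m) ne'.
rewrite !lattice_ptE; set u := lattice_pt _ _ _; set v := lattice_pt _ _ _.
have -> : c i + u * z - (c j + v * z) = (c i / z + u - (c j / z + v)) * z by field.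
rewrite csqM zE => h.
have -> : distSq (vadd (p i) (lat L (L * (Num.sqrt 3 / 2)) l))
  (vadd (p j) (lat L (L * (Num.sqrt 3 / 2)) m)) =
   L ^+ 2 * csq (c i / z + u - (c j / z + v)).
  rewrite /u /v !unit_lattice_ptE /distSq /vadd /lat /p /csq.
  by case: (c i / z) (c j / z) => [x y] [x' y'] /=; field.
have r4 : 0 < 4 * r ^+ 2 by rewrite mulr_gt0// exprn_gt0.
by rewrite L2 -(ler_pM2r r4); lra.
Qed.

Lemma csq_unit_lattice (m : int * int) :
  csq (lattice_pt 1 (g_triangle R) m) = (m.1 ^+ 2 + m.1 * m.2 + m.2 ^+ 2)%:~R.
Proof.
have s3 : Num.sqrt 3 ^+ 2 = 3 :> R by rewrite sqr_sqrtr.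
rewrite unit_lattice_ptE /csq/= !rmorphD/= !rmorphXn/= rmorphM/= exprMn expr_div_n s3.
by field.
Qed.

(** For z = n1 + n2 w, the lattice is the ideal generated by z in Z[w]. The centres represent n
    residue classes, with r = 1/2 because distinct elements of Z[w] are at distance at least 1. *)
Lemma packing_of_loeschian n (n1 n2 : int) : (0 < n)%N ->
  n%:Z = n1 ^+ 2 + n1 * n2 + n2 ^+ 2 ->
  exists z : R[i], z != 0 /\ exists (c : 'I_n -> R[i]) (r : R),
    is_torus_packing (lattice z (g_triangle R * z)) c r /\
    csq z = 4 * n%:R * r ^+ 2.
Proof.
move=> n0 nE; pose z : R[i] := lattice_pt 1 (g_triangle R) (n1, n2).
have zn : csq z = n%:R by rewrite csq_unit_lattice/= -nE -pmulrn.
exists z; split; first by rewrite -csq_gt0 zn ltr0n.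
have [f fP] := eisenstein_residues n0 nE.
exists (fun i => lattice_pt 1 (g_triangle R) (f i)), (1 / 2).
split; last by rewrite zn; field.
split=> // i j _ _ [k _ <-] [l _ <-] ne; apply/interior_disk => //.
have s3 : Num.sqrt 3 ^+ 2 = 3 :> R by rewrite sqr_sqrtr.
have e t : lattice_pt z (g_triangle R * z) t = lattice_pt 1 (g_triangle R)
    (t.1 * n1 - t.2 * n2, t.1 * n2 + t.2 * (n1 + n2)).
  rewrite lattice_ptE /z !unit_lattice_ptE/= !(rmorphB, rmorphD, rmorphM)/=.
  by apply/eqP; rewrite eq_complex/=; apply/andP; split; apply/eqP; field: s3.
have B s t : lattice_pt 1 (g_triangle R) s - lattice_pt 1 (g_triangle R) t =
   lattice_pt 1 (g_triangle R) (s.1 - t.1, s.2 - t.2).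
  by rewrite /lattice_pt/= !rmorphB/=; ring.
have D s t : lattice_pt 1 (g_triangle R) s + lattice_pt 1 (g_triangle R) t =
   lattice_pt 1 (g_triangle R) (s.1 + t.1, s.2 + t.2).
  by rewrite /lattice_pt/= !rmorphD/=; ring.
rewrite !e !D B csq_unit_lattice/=.
set a := _ - _ : int; set b := _ - _ : int.
(* Equal lifts would make the centres congruent modulo z; then i = j, and the lattice vectors agree
   too. *)
have ab : (a, b) != (0, 0).
  apply/eqP => -[a0 b0]; apply: ne.
  have ij : i = j.
    apply: (fP i j (l.1 - k.1) (l.2 - k.2)).
      by apply/eqP; rewrite -subr_eq0 -a0 /a; apply/eqP; ring.
    by apply/eqP; rewrite -subr_eq0 -b0 /b; apply/eqP; ring.
  congr (_, _); first exact: ij.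
  rewrite !e; congr (lattice_pt _ _ (_, _)); apply/eqP; rewrite -subr_eq0.
    by rewrite -a0 /a ij; apply/eqP; ring.
  by rewrite -b0 /b ij; apply/eqP; ring.
have := hexZ_gt0 ab; rewrite -(ler_int R); lra.
Qed.

End Main.

Theorem theorem1 (R : realType) (n : nat) (hn : (1 <= n)%N) :
  (exists z : R[i], z != 0 /\
     exists (c : 'I_n -> R[i]) (r : R),
       is_torus_packing (lattice z (g_triangle R * z)) c r /\
       torus_density z (g_triangle R * z) n r = delta_triangle R)
  <->
  (exists n1 n2 : int, n%:Z = n1 ^+ 2 + n1 * n2 + n2 ^+ 2).
Proof.
split=> [[z [z0 [c [r [pack /(triangular_density _ _ z0) zE]]]]]|[n1 [n2 nE]]].
  exact: loeschian_of_packing pack zE.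
have [z [z0 [c [r [pack zE]]]]] := packing_of_loeschian (R := R) hn nE.
by exists z; split=> //; exists c, r; split=> //; exact/triangular_density.
Qed.
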